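(* Let $k$ be a field of characteristic $2$ containing $\mathbb{F}_4=\{0,1,j,j^2\}$ and let $n\ge 3$. There exists a quotient $\mathcal{H}_n$ of the algebra $kK_n=k\Gamma_n/(\mathbf{q})$ which has dimension $3(n!-1)$ over $k$ and which embeds inside the product of three Hecke algebras $H_n(1,j)\times H_n(1,j^2)\times H_n(j,j^2)$. This algebra $\mathcal{H}_n$ is the quotient of $k\Gamma_n$ by the relation $s_1s_2^{-1}+s_2s_1^{-1}+s_1^{-1}s_2+s_2^{-1}s_1=0$.
   Context: $\Gamma_n$ is the group with generators $s_1,\dots,s_{n-1}$ and relations $s_is_j=s_js_i$ for $|i-j|\ge 2$, $s_is_{i+1}s_i=s_{i+1}s_is_{i+1}$ for $1\le i\le n-2$, and $s_i^3=1$. The kernel $Q$ of the morphism $\Gamma_3\to C_3$ sending $s_1,s_2$ to a fixed generator of $C_3$ is a quaternion group of order $8$; $\mathbf{q}=\sum_{g\in Q}g$, viewed in the group algebra of $\Gamma_n$ via the natural morphism $\Gamma_3\to\Gamma_n$, and $(\mathbf{q})$ is the two-sided ideal it generates in $k\Gamma_n$. For $\alpha,\beta\in k$, $H_n(\alpha,\beta)$ is the Hecke algebra $k\Gamma_n/J_n(\alpha,\beta)$, where $J_n(\alpha,\beta)$ is the two-sided ideal generated by $(s_1-\alpha)(s_1-\beta)$. *)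

(* Defs.v *)
From HB Require Import structures.
From mathcomp Require Import all_boot all_order all_algebra falgebra.
From mathcomp Require Import finmap.
From mathcomp Require Import boolp classical_sets fsbigop.
From mathcomp Require Import monalg.

Set Implicit Arguments.
Unset Strict Implicit.
Unset Printing Implicit Defensive.

Import GRing.Theory.
Import Quotient.

Local Open Scope quotient_scope.
Local Open Scope ring_scope.

(* Groups given by generators and relations. A word is a sequence of letters
   (i, b), where (i, false) stands for the generator i and (i, true) for its
   inverse. *)
Definition word (I : Type) := seq (I * bool).

Definition letter_inv (I : Type) (l : I * bool) : I * bool := (l.1, ~~ l.2).

Inductive word_eq (I : Type) (R : word I -> word I -> Prop) :
    word I -> word I -> Prop :=
  | WordRel u v of R u v : word_eq R u v
  | WordInv l : word_eq R [:: l; letter_inv l] [::]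
  | WordCat u v w z of word_eq R u v & word_eq R w z :
      word_eq R (u ++ w) (v ++ z)
  | WordRefl u : word_eq R u u
  | WordSym u v of word_eq R u v : word_eq R v u
  | WordTrans v u w of word_eq R u v & word_eq R v w : word_eq R u w.

Section PresentedGroup.
Variables (I : choiceType) (R : word I -> word I -> Prop).

Definition word_eqb : rel (word I) := fun u v => `[< word_eq R u v >].

Fact word_eqb_equiv : equiv_class_of word_eqb.
Proof.
split=> [u|u v|v u w]; first by apply/asboolP; exact: WordRefl.
  by apply/asboolP/asboolP; exact: WordSym.
by move=> /asboolP uv /asboolP vw; apply/asboolP; exact: WordTrans vw.
Qed.

Canonical word_eqb_equiv_rel := EquivRelPack word_eqb_equiv.

Definition pres_group := {eq_quot word_eqb}.
HB.instance Definition _ := Choice.on pres_group.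
HB.instance Definition _ := EqQuotient.on pres_group.

Definition word_inv (u : word I) : word I := rev (map (@letter_inv I) u).

Definition pres_one : pres_group := \pi_pres_group [::].
Definition pres_mul : pres_group -> pres_group -> pres_group :=
  lift_op2 pres_group (@cat (I * bool)).
Definition pres_inv : pres_group -> pres_group := lift_op1 pres_group word_inv.

Lemma pi_presP u v : (\pi_pres_group u = \pi_pres_group v) <-> word_eq R u v.
Proof.
by split=> [/(eqmodP word_eqb_equiv_rel)/asboolP | /asboolP/(eqmodP word_eqb_equiv_rel)].
Qed.

Lemma repr_pi_pres u : word_eq R (repr (\pi_pres_group u)) u.
Proof. by apply/pi_presP; rewrite reprK. Qed.

Lemma pres_mulE u v :
  pres_mul (\pi_pres_group u) (\pi_pres_group v) = \pi_pres_group (u ++ v).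
Proof.
by unlock pres_mul; apply/pi_presP; apply: WordCat; exact: repr_pi_pres.
Qed.

Fact pres_mulA : associative pres_mul.
Proof.
elim/quotW=> x; elim/quotW=> y; elim/quotW=> z.
by rewrite (pres_mulE y z) (pres_mulE x y) !pres_mulE catA.
Qed.

Fact pres_mul1g : left_id pres_one pres_mul.
Proof. by elim/quotW=> x; rewrite pres_mulE. Qed.

Fact pres_mulg1 : right_id pres_one pres_mul.
Proof. by elim/quotW=> x; rewrite pres_mulE cats0. Qed.

Lemma word_mulV (u : word I) :
  word_eq R (u ++ word_inv u) [::].
Proof.
elim: u => [|l u IHu]; first exact: WordRefl.
rewrite /word_inv /= rev_cons -cats1 catA.
apply: WordTrans (WordInv R l).
exact: (WordCat (WordRefl R [:: l]) (WordCat IHu (WordRefl R [:: letter_inv l]))).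
Qed.

Lemma letter_invK : involutive (@letter_inv I).
Proof. by case=> i b; rewrite /letter_inv negbK. Qed.

Lemma word_invK : involutive word_inv.
Proof.
by move=> u; rewrite /word_inv map_rev revK -map_comp (eq_map letter_invK) map_id.
Qed.

Fact pres_mulgV : right_inverse pres_one pres_inv pres_mul.
Proof.
move=> x; unlock pres_inv; rewrite -{1}[x]reprK pres_mulE.
by apply/pi_presP; exact: word_mulV.
Qed.

Fact pres_mulVg : left_inverse pres_one pres_inv pres_mul.
Proof.
move=> x; unlock pres_inv; rewrite -{2}[x]reprK pres_mulE; apply/pi_presP.
rewrite -{2}[repr x]word_invK; exact: word_mulV.
Qed.

HB.instance Definition _ := isGroup.Build pres_group
  pres_mulA pres_mul1g pres_mulg1 pres_mulVg pres_mulgV.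

Lemma pi_presM u v : (\pi_pres_group u * \pi_pres_group v)%g =
  \pi_pres_group (u ++ v) :> pres_group.
Proof. exact: pres_mulE. Qed.

Definition pres_gen (i : I) : pres_group := \pi_pres_group [:: (i, false)].

End PresentedGroup.

Section PresentedGroupMorphism.
Variables (I : choiceType) (G : groupType) (f : I -> G).

Definition word_eval (w : word I) : G :=
  (\prod_(l <- w) (if l.2 then (f l.1)^-1 else f l.1))%g.

Variable R : word I -> word I -> Prop.

(* The morphism determined by images of the generators that satisfy the
   relations. *)
Definition pres_lift of (forall u v, R u v -> word_eval u = word_eval v) :
  pres_group R -> G := fun x => word_eval (repr x).

Hypothesis fR : forall u v, R u v -> word_eval u = word_eval v.

Lemma word_eval_cat u v :
  word_eval (u ++ v) = (word_eval u * word_eval v)%g.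
Proof. exact: big_cat. Qed.

Lemma word_eval_eq u v : word_eq R u v -> word_eval u = word_eval v.
Proof.
elim=> {u v} // [[i b]|u v w z _ uv _ wz|u v w _ -> _ ->//].
  by rewrite /word_eval !big_cons big_nil mulg1 /=; case: b; rewrite gsimp.
by rewrite !word_eval_cat uv wz.
Qed.

Lemma pres_lift_pi u : pres_lift fR (\pi_(pres_group R) u) = word_eval u.
Proof. exact/word_eval_eq/repr_pi_pres. Qed.

Lemma pres_lift_gen i : pres_lift fR (pres_gen R i) = f i.
Proof. by rewrite pres_lift_pi /word_eval big_seq1. Qed.

Fact pres_lift_monoid_morphism : monoid.monoid_morphism (pres_lift fR).
Proof.
split=> [|x y]; first by rewrite pres_lift_pi /word_eval big_nil.
elim/quotW: x => u; elim/quotW: y => v.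
by rewrite pi_presM !pres_lift_pi word_eval_cat.
Qed.

HB.instance Definition _ :=
  isUMagmaMorphism.Build (pres_group R) G (pres_lift fR)
    pres_lift_monoid_morphism.

End PresentedGroupMorphism.

Definition gamma_index (n : nat) := {i : nat | 0 < i < n}%N.

Inductive gamma_rel (n : nat) :
    word (gamma_index n) -> word (gamma_index n) -> Prop :=
  | GammaFar (i j : gamma_index n) of
      (val i + 2 <= val j)%N || (val j + 2 <= val i)%N :
      gamma_rel [:: (i, false); (j, false)] [:: (j, false); (i, false)]
  | GammaBraid (i j : gamma_index n) of val j = (val i).+1 :
      gamma_rel [:: (i, false); (j, false); (i, false)]
                [:: (j, false); (i, false); (j, false)]
  | GammaCube (i : gamma_index n) :
      gamma_rel [:: (i, false); (i, false); (i, false)] [::].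

Definition gamma (n : nat) := pres_group (@gamma_rel n).
HB.instance Definition _ n := Group.on (gamma n).

(* sgen n i is the generator s_i for 1 <= i <= n-1; for other values of i it is
   set to 1. *)
Definition sgen (n i : nat) : gamma n :=
  if insub i is Some i' then pres_gen (@gamma_rel n) i' else 1%g.

Lemma sgen_val n (i : gamma_index n) : sgen n (val i) = pres_gen (@gamma_rel n) i.
Proof. by rewrite /sgen valK. Qed.

Lemma sgen_far n i j : (0 < i < n)%N -> (0 < j < n)%N ->
  (i + 2 <= j)%N || (j + 2 <= i)%N -> (sgen n i * sgen n j = sgen n j * sgen n i)%g.
Proof.
move=> hi hj hij.
rewrite -[i]/(val (Sub i hi : gamma_index n)).
rewrite -[j]/(val (Sub j hj : gamma_index n)) !sgen_val /pres_gen !pi_presM.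
by apply/pi_presP/WordRel/GammaFar.
Qed.

Lemma sgen_braid n i : (0 < i)%N -> (i.+1 < n)%N ->
  (sgen n i * sgen n i.+1 * sgen n i = sgen n i.+1 * sgen n i * sgen n i.+1)%g.
Proof.
move=> i_gt0 hi; have hi0 : (0 < i < n)%N by rewrite i_gt0 ltnW.
rewrite (sgen_val (Sub i hi0 : gamma_index n)) (sgen_val (Sub i.+1 hi : gamma_index n)).
rewrite /pres_gen !pi_presM.
apply/pi_presP/WordRel.
exact: (@GammaBraid n (Sub i hi0) (Sub i.+1 hi) erefl).
Qed.

Lemma sgen_cube n i : (sgen n i ^+ 3 = 1)%g.
Proof.
rewrite /sgen; case: insubP => [i' _ _|_]; last by rewrite expg1n.
rewrite !expgS expg0 mulg1 /pres_gen !pi_presM.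
by apply/pi_presP/WordRel/GammaCube.
Qed.

Lemma word_eval_consE (I : choiceType) (G : groupType) (f : I -> G) l w :
  word_eval f (l :: w) =
    ((if l.2 then (f l.1)^-1 else f l.1) * word_eval f w)%g.
Proof. exact: big_cons. Qed.

Lemma word_eval_nil (I : choiceType) (G : groupType) (f : I -> G) :
  word_eval f [::] = 1%g.
Proof. exact: big_nil. Qed.

Definition word_evalE := (@word_eval_consE, @word_eval_nil, @mulg1).

Fact gamma_map_subproof m n (le_mn : (m <= n)%N) u v :
  @gamma_rel m u v ->
  word_eval (fun i => sgen n (val i)) u = word_eval (fun i => sgen n (val i)) v.
Proof.
have ltn i : (i < m -> i < n)%N by move=> /leq_trans; exact.
case=> {u v} [i j ij|i j ij|i]; rewrite !word_evalE /=.
- case/andP: (valP i) (valP j) => i_gt0 /ltn im /andP[j_gt0 /ltn jm].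
  by apply: sgen_far => //; apply/andP.
- case/andP: (valP i) (valP j) => i_gt0 _ /andP[_ /ltn].
  rewrite ij !mulgA => jn; rewrite (ij : sval j = _); exact: sgen_braid.
- exact: (sgen_cube n (val i)).
Qed.

(* The natural morphism Gamma_m -> Gamma_n, s_i |-> s_i. *)
Definition gamma_map m n (le_mn : (m <= n)%N) : gamma m -> gamma n :=
  pres_lift (gamma_map_subproof le_mn).
HB.instance Definition _ m n (le_mn : (m <= n)%N) :=
  UMagmaMorphism.on (gamma_map le_mn).

Lemma gamma_map_sgen m n (le_mn : (m <= n)%N) i :
  (i < m)%N -> gamma_map le_mn (sgen m i) = sgen n i.
Proof.
rewrite {1}/sgen; case: insubP => [i' _ <- _|]; first exact: pres_lift_gen.
case: i => [_ _|i /= /[swap] ->//]; rewrite gmulf1 /sgen.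
by case: insubP => // u; rewrite ltnn.
Qed.

Fact gamma_C3_subproof n u v :
  @gamma_rel n u v ->
  word_eval (fun=> Zp1 : 'Z_3) u = word_eval (fun=> Zp1 : 'Z_3) v.
Proof.
by case=> {u v} [i j _|i j _|i]; rewrite !word_evalE //=; apply/val_inj.
Qed.

(* The cyclic group C_3 is 'Z_3, whose group law is addition, with fixed
   generator Zp1. *)
Definition gamma_C3 n : gamma n -> 'Z_3 := pres_lift (@gamma_C3_subproof n).
HB.instance Definition _ n := UMagmaMorphism.on (@gamma_C3 n).

Definition Q : set (gamma 3) := [set g | @gamma_C3 3 g = 1%g].

Section GroupAlgebra.
Variables (k : comNzRingType) (G : groupType).

Definition group_algebra := {malg k[G]}.
HB.instance Definition _ := GRing.Lmodule.on group_algebra.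

Implicit Types (a b c : group_algebra) (g h : G).

Definition galg_of g : group_algebra := << 1 *g g >>.

Definition galg_mul a b : group_algebra :=
  \sum_(g <- msupp a) \sum_(h <- msupp b) << a@_g * b@_h *g (g * h)%g >>.

Lemma malg_scaleU (x y : k) g : x *: << y *g g >> = << x * y *g g >> :> group_algebra.
Proof.
by apply/malgP=> h; rewrite mcoeffZ !mcoeffU mulrnAr.
Qed.

Lemma galgE a : a = \sum_(g <- msupp a) a@_g *: galg_of g.
Proof.
by rewrite {1}[a]monalgE; apply: eq_bigr => g _; rewrite malg_scaleU mulr1.
Qed.

Lemma galg_mulEw (d1 d2 : {fset G}) a b :
  (msupp a `<=` d1)%fset -> (msupp b `<=` d2)%fset ->
  galg_mul a b =
    \sum_(g <- d1) \sum_(h <- d2) << a@_g * b@_h *g (g * h)%g >>.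
Proof.
move=> le1 le2; rewrite /galg_mul (big_fset_incl _ le1) /=.
  apply/eq_bigr=> g _; apply/big_fset_incl => // h _ /mcoeff_outdom ->.
  by rewrite mulr0 monalgU0.
by move=> g _ /mcoeff_outdom ag; rewrite big1 // => h _; rewrite ag mul0r monalgU0.
Qed.

Lemma galg_mulDl : left_distributive galg_mul +%R.
Proof.
move=> a b c.
rewrite (galg_mulEw (msuppD_le _ _) (fsubset_refl _)).
rewrite (galg_mulEw (fsubsetUl _ (msupp b)) (fsubset_refl (msupp c))).
rewrite (galg_mulEw (fsubsetUr (msupp a) _) (fsubset_refl (msupp c))).
rewrite -big_split; apply: eq_bigr => g _; rewrite -big_split.
by apply: eq_bigr => h _; rewrite mcoeffD mulrDl monalgUD.
Qed.

Lemma galg_mulDr : right_distributive galg_mul +%R.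
Proof.
move=> c a b.
rewrite (galg_mulEw (fsubset_refl _) (msuppD_le _ _)).
rewrite (galg_mulEw (fsubset_refl (msupp c)) (fsubsetUl _ (msupp b))).
rewrite (galg_mulEw (fsubset_refl (msupp c)) (fsubsetUr (msupp a) _)).
rewrite -big_split; apply: eq_bigr => g _; rewrite -big_split.
by apply: eq_bigr => h _; rewrite mcoeffD mulrDr monalgUD.
Qed.

Lemma galg_mulZl x a b : x *: galg_mul a b = galg_mul (x *: a) b.
Proof.
rewrite (galg_mulEw (msuppZ_le x a) (fsubset_refl (msupp b))) scaler_sumr.
apply: eq_bigr => g _; rewrite scaler_sumr; apply: eq_bigr => h _.
by rewrite malg_scaleU mcoeffZ mulrA.
Qed.

Lemma galg_mulZr x a b : x *: galg_mul a b = galg_mul a (x *: b).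
Proof.
rewrite (galg_mulEw (fsubset_refl (msupp a)) (msuppZ_le x b)) scaler_sumr.
apply: eq_bigr => g _; rewrite scaler_sumr; apply: eq_bigr => h _.
by rewrite malg_scaleU mcoeffZ mulrCA.
Qed.

Lemma galg_mul_of g h : galg_mul (galg_of g) (galg_of h) = galg_of (g * h)%g.
Proof.
by rewrite (galg_mulEw msuppU_le msuppU_le) !big_seq_fset1 !mcoeffUU mulr1.
Qed.

Lemma galg_mul0l a : galg_mul 0 a = 0.
Proof. by rewrite /galg_mul msupp0 big_seq_fset0. Qed.

Lemma galg_mul0r a : galg_mul a 0 = 0.
Proof.
by rewrite /galg_mul big1 // => g _; rewrite msupp0 big_seq_fset0.
Qed.

Lemma galg_mul_suml (I : Type) (r : seq I) (F : I -> group_algebra) b :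
  galg_mul (\sum_(i <- r) F i) b = \sum_(i <- r) galg_mul (F i) b.
Proof.
exact: (big_morph (galg_mul^~ b) (fun _ _ => galg_mulDl _ _ _) (galg_mul0l b)).
Qed.

Lemma galg_mul_sumr (I : Type) (r : seq I) (F : I -> group_algebra) a :
  galg_mul a (\sum_(i <- r) F i) = \sum_(i <- r) galg_mul a (F i).
Proof.
exact: (big_morph (galg_mul a) (fun _ _ => galg_mulDr _ _ _) (galg_mul0r a)).
Qed.

Fact galg_mulA : associative galg_mul.
Proof.
move=> a b c; rewrite (galgE a) (galg_mul_suml _ _ b) !(galg_mul_suml _ _ c).
rewrite galg_mul_suml; apply: eq_bigr => g _.
rewrite -(galg_mulZl _ _ b) -(galg_mulZl _ _ c) -galg_mulZl; congr (_ *: _).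
rewrite (galgE b) (galg_mul_suml _ _ c) (galg_mul_sumr _ _ (galg_of g)).
rewrite (galg_mul_sumr _ _ (galg_of g)) (galg_mul_suml _ _ c).
apply: eq_bigr => h _.
rewrite -(galg_mulZl _ _ c) -2!(galg_mulZr _ (galg_of g)) -(galg_mulZl _ _ c).
congr (_ *: _); rewrite (galgE c) (galg_mul_sumr _ _ (galg_of h)).
rewrite galg_mul_of 2!galg_mul_sumr; apply: eq_bigr => l _.
by rewrite -!galg_mulZr !galg_mul_of mulgA.
Qed.

Fact galg_mul1l : left_id (galg_of 1%g) galg_mul.
Proof.
move=> a; rewrite (galgE a) galg_mul_sumr; apply: eq_bigr => g _.
by rewrite -galg_mulZr galg_mul_of mul1g.
Qed.

Fact galg_mul1r : right_id (galg_of 1%g) galg_mul.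
Proof.
move=> a; rewrite (galgE a) galg_mul_suml; apply: eq_bigr => g _.
by rewrite -galg_mulZl galg_mul_of mulg1.
Qed.

Fact galg_oner_neq0 : galg_of 1%g != 0.
Proof. by rewrite monalgU_eq0 oner_neq0. Qed.

HB.instance Definition _ := GRing.Zmodule_isNzRing.Build group_algebra
  galg_mulA galg_mul1l galg_mul1r galg_mulDl galg_mulDr galg_oner_neq0.
HB.instance Definition _ :=
  GRing.Lmodule_isLalgebra.Build k group_algebra galg_mulZl.
HB.instance Definition _ :=
  GRing.Lalgebra_isAlgebra.Build k group_algebra galg_mulZr.

Lemma galg_of_monoid_morphism :
  (galg_of 1%g = 1) * {morph galg_of : g h / (g * h)%g >-> g * h}.
Proof. by split=> // g h; rewrite -galg_mul_of. Qed.

End GroupAlgebra.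
Arguments galg_of k {G} g.

Inductive ideal_gen (A : pzRingType) (X : set A) : A -> Prop :=
  | IdealMem x of X x : ideal_gen X x
  | Ideal0 : ideal_gen X 0
  | IdealD x y of ideal_gen X x & ideal_gen X y : ideal_gen X (x + y)
  | IdealMl a x of ideal_gen X x : ideal_gen X (a * x)
  | IdealMr a x of ideal_gen X x : ideal_gen X (x * a).

Section QuotientAlgebra.
Variables (k : comNzRingType) (A : algType k) (X : set A).

Definition ideal_pred : {pred A} := fun x => `[< ideal_gen X x >].

Lemma ideal_predP x : reflect (ideal_gen X x) (x \in ideal_pred).
Proof. exact: asboolP. Qed.

Fact ideal_pred_zmod_closed : zmod_closed ideal_pred.
Proof.
split=> [|x y /ideal_predP Ix /ideal_predP Iy]; apply/ideal_predP.
  exact: Ideal0.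
by apply: IdealD => //; rewrite -mulN1r; exact: IdealMl.
Qed.
HB.instance Definition _ :=
  GRing.isZmodClosed.Build A ideal_pred ideal_pred_zmod_closed.

(* The quotient of A by the two-sided ideal generated by X. It is the zero ring
   when this ideal contains 1, hence it carries the structures of ring and of
   k-module, but not that of algType k, which requires 1 != 0. *)
Definition quot_alg := {quot ideal_pred}.
HB.instance Definition _ := GRing.Zmodule.on quot_alg.
HB.instance Definition _ := EqQuotient.on quot_alg.

Definition quot_proj (x : A) : quot_alg := \pi_quot_alg x.

Lemma quot_projP x y : quot_proj x = quot_proj y <-> ideal_gen X (x - y).
Proof.
split; first by move=> /eqP; rewrite -idealrBE => /ideal_predP.
by move=> /ideal_predP; rewrite idealrBE => /eqP.
Qed.

Lemma quot_proj_surj (y : quot_alg) : exists x, quot_proj x = y.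
Proof. by exists (repr y); exact: reprK. Qed.

Definition quot_one : quot_alg := quot_proj 1.
Definition quot_mul : quot_alg -> quot_alg -> quot_alg := lift_op2 quot_alg *%R.
Definition quot_scale (c : k) : quot_alg -> quot_alg :=
  lift_op1 quot_alg ( *:%R c).

Lemma repr_quot_proj x : ideal_gen X (repr (quot_proj x) - x).
Proof. by apply/quot_projP; rewrite /quot_proj reprK. Qed.

Lemma quot_mulE x y : quot_mul (quot_proj x) (quot_proj y) = quot_proj (x * y).
Proof.
unlock quot_mul; apply/quot_projP; set x' := repr _; set y' := repr _.
have -> : x' * y' - x * y = (x' - x) * y' + x * (y' - y).
  by rewrite mulrBl mulrBr addrA subrK.
by apply: IdealD; [apply: IdealMr|apply: IdealMl]; exact: repr_quot_proj.
Qed.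

Lemma quot_scaleE c x : quot_scale c (quot_proj x) = quot_proj (c *: x).
Proof.
unlock quot_scale; apply/quot_projP; rewrite -scalerBr -mulr_algl.
by apply: IdealMl; exact: repr_quot_proj.
Qed.

Lemma quot_projD x y : quot_proj (x + y) = quot_proj x + quot_proj y.
Proof. by rewrite /quot_proj !piE. Qed.

Lemma quot_algW (P : quot_alg -> Prop) :
  (forall x, P (quot_proj x)) -> forall y, P y.
Proof. by move=> Pp y; have [x <-] := quot_proj_surj y. Qed.

Fact quot_mulA : associative quot_mul.
Proof.
elim/quot_algW=> x; elim/quot_algW=> y; elim/quot_algW=> z.
by rewrite !quot_mulE mulrA.
Qed.

Fact quot_mul1l : left_id quot_one quot_mul.
Proof. by elim/quot_algW=> x; rewrite quot_mulE mul1r. Qed.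

Fact quot_mul1r : right_id quot_one quot_mul.
Proof. by elim/quot_algW=> x; rewrite quot_mulE mulr1. Qed.

Fact quot_mulDl : left_distributive quot_mul +%R.
Proof.
elim/quot_algW=> x; elim/quot_algW=> y; elim/quot_algW=> z.
by rewrite -quot_projD !quot_mulE mulrDl quot_projD.
Qed.

Fact quot_mulDr : right_distributive quot_mul +%R.
Proof.
elim/quot_algW=> x; elim/quot_algW=> y; elim/quot_algW=> z.
by rewrite -quot_projD !quot_mulE mulrDr quot_projD.
Qed.

HB.instance Definition _ := GRing.Zmodule_isPzRing.Build quot_alg
  quot_mulA quot_mul1l quot_mul1r quot_mulDl quot_mulDr.

Fact quot_scaleA c d x : quot_scale c (quot_scale d x) = quot_scale (c * d) x.
Proof. by elim/quot_algW: x => x; rewrite !quot_scaleE scalerA. Qed.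

Fact quot_scale1 : left_id 1 quot_scale.
Proof. by elim/quot_algW=> x; rewrite quot_scaleE scale1r. Qed.

Fact quot_scaleDr : right_distributive quot_scale +%R.
Proof.
move=> c; elim/quot_algW=> x; elim/quot_algW=> y.
by rewrite -quot_projD !quot_scaleE scalerDr quot_projD.
Qed.

Fact quot_scaleDl x : {morph quot_scale^~ x : c d / c + d}.
Proof.
move=> c d; elim/quot_algW: x => x.
by rewrite !quot_scaleE scalerDl quot_projD.
Qed.

HB.instance Definition _ := GRing.Zmodule_isLmodule.Build k quot_alg
  quot_scaleA quot_scale1 quot_scaleDr quot_scaleDl.

Lemma quot_scalerAl (c : k) (x y : quot_alg) : c *: (x * y) = (c *: x) * y.
Proof.
elim/quot_algW: x => x; elim/quot_algW: y => y.
rewrite -[quot_proj x * _]/(quot_mul _ _) -[_ * quot_proj y]/(quot_mul _ _).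
by rewrite quot_mulE -![_ *: _]/(quot_scale _ _) !quot_scaleE quot_mulE scalerAl.
Qed.

Lemma quot_scalerAr (c : k) (x y : quot_alg) : c *: (x * y) = x * (c *: y).
Proof.
elim/quot_algW: x => x; elim/quot_algW: y => y.
rewrite -![quot_proj x * _]/(quot_mul _ _) -![_ *: _]/(quot_scale _ _).
by rewrite quot_mulE !quot_scaleE quot_mulE scalerAr.
Qed.

Fact quot_proj_zmod_morphism : zmod_morphism quot_proj.
Proof. by move=> x y; rewrite /quot_proj !piE. Qed.
HB.instance Definition _ :=
  GRing.isZmodMorphism.Build A quot_alg quot_proj quot_proj_zmod_morphism.

Fact quot_proj_monoid_morphism : monoid_morphism quot_proj.
Proof. by split=> // x y; rewrite -quot_mulE. Qed.
HB.instance Definition _ :=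
  GRing.isMonoidMorphism.Build A quot_alg quot_proj quot_proj_monoid_morphism.

Fact quot_proj_scalable : scalable quot_proj.
Proof. by move=> c x; rewrite -quot_scaleE. Qed.
HB.instance Definition _ :=
  GRing.isScalable.Build k A quot_alg *:%R quot_proj quot_proj_scalable.

Lemma quot_proj_eq0 x : quot_proj x = 0 <-> ideal_gen X x.
Proof. by rewrite -(rmorph0 quot_proj) quot_projP subr0. Qed.

End QuotientAlgebra.

Section Algebras.
Variables (k : comNzRingType) (n : nat).

Let S i : group_algebra k (gamma n) := galg_of k (sgen n i).

(* The element q, for n >= 3. The set Q is finite (it has 8 elements), so that
   the finitely supported sum below is the sum over all the elements of Q. *)
Definition q_elt (le3n : (3 <= n)%N) : group_algebra k (gamma n) :=
  \sum_(g \in Q) galg_of k (gamma_map le3n g).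

Definition kK (le3n : (3 <= n)%N) := quot_alg [set q_elt le3n]%classic.
HB.instance Definition _ le3n := GRing.PzRing.on (kK le3n).
HB.instance Definition _ le3n := GRing.Lmodule.on (kK le3n).

Definition hecke_rel (a b : k) : group_algebra k (gamma n) :=
  (S 1 - a%:A) * (S 1 - b%:A).

Definition hecke (a b : k) := quot_alg [set hecke_rel a b]%classic.
HB.instance Definition _ a b := GRing.PzRing.on (hecke a b).
HB.instance Definition _ a b := GRing.Lmodule.on (hecke a b).

Definition main_rel : group_algebra k (gamma n) :=
  galg_of k (sgen n 1 * (sgen n 2)^-1)%g
  + galg_of k (sgen n 2 * (sgen n 1)^-1)%g
  + galg_of k ((sgen n 1)^-1 * sgen n 2)%g
  + galg_of k ((sgen n 2)^-1 * sgen n 1)%g.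

End Algebras.

(* Main.v *)
(* Let a = s_1 and {al, be, ga} = {1, j, j^2}. As s_i^3 = 1, the algebra
   H_n(al, be) is the quotient of the group algebra by the projection p_ga(a) of
   a onto its eigenvalue ga, and the main relation, quat_rel a b with b = s_2,
   lies in the three ideals I_c = (p_c(a)). The point is that I_1, I_j and
   I_(j^2) meet in no more than the ideal of the main relation.

   In the quotient A by this relation, any three generators satisfy
   cross3 x y z = 0. This is the condition under which one can adjoin to A a
   central element t with t^3 = 1 and t (s_i - s_r) = s_i^-1 - s_r^-1. Let x be
   annihilated by the three characters s_i |-> c. Then t x lies in A, and the
   element cusp c x = (t (a - c) - (a^-1 - c^-1)) x of A is 0 when x is in I_c. If
   x is in the three ideals, a linear combination of these three equations gives
   x = 0 in A.

   Each Hecke algebra has dimension n!, and two of them have a single common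
   character, so the Chinese remainder theorem gives the image in their product
   the dimension 3 n! - 3. Finally q is a sum over the orbits of the left
   multiplication by u = s_1 s_2 s_1, of order 4, and 1 + u + u^2 + u^3 is the
   main relation times s_2^2 s_1: thus q vanishes in the quotient. *)
From HB Require Import structures.
Require Import Defs.
From mathcomp Require Import all_fingroup all_boot all_order all_algebra falgebra.
From mathcomp Require Import zify ring finmap.
From mathcomp Require Import boolp classical_sets fsbigop monalg.

Set Implicit Arguments.
Unset Strict Implicit.
Unset Printing Implicit Defensive.

Import GRing.Theory.

Local Open Scope quotient_scope.
Local Open Scope ring_scope.

(** Why the cusp argument works: in A[t] the element e_c = t (s_i - c) - (s_i^-1 - c^-1) is the same
    for all i, by the relation defining t. It therefore commutes with every s_i and is central; it
    kills p_c(s_1), on which s_1 acts as c, hence all of I_c. The obstacle is that t need not be in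
    A, and A[t] is never built. What is available is the A-valued map x |-> t x - s_r^(deg x) t,
    read off from a triangular action on A x A. Its second term is the sum over c of chi_c(x)
    p_c(s_r) t, where chi_c is the character s_i |-> c; it vanishes on the common kernel of the
    characters. An element of I_c is moved into this kernel by a multiple of p_c(s_1). The final
    combination is the sum of c e_c over c in {1, j, j^2}: there the sums of c and of c^2 are 0 and
    that of c^3 is 3 = 1, so t disappears and x remains. For the dimension, three ideals need a
    distributivity that pairwise Chinese remainders do not give; it comes from 1 = p_1 + p_j +
    p_(j^2), multiplied by elements split along two ideals. *)

(** * Deciding identities over F_4 in noncommuting variables, modulo word rewriting *)

Inductive f4expr :=
  F4var of nat | F4zero | F4one | F4omega
| F4add of f4expr & f4expr | F4mul of f4expr & f4expr.

(* A term is a pair (b, u) standing for w^b u, with u a word in the variables;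
   a polynomial is a list of terms in which equal terms cancel. *)
Definition f4term := (bool * seq nat)%type.

Definition f4_toggle (t : f4term) (p : seq f4term) :=
  if t \in p then rem t p else t :: p.

Definition cube_rule i : seq nat * seq nat := ([:: i; i; i], [::]).
Definition comm_rule i j : seq nat * seq nat := ([:: i; j], [:: j; i]).
Definition braid_rule i j : seq nat * seq nat := ([:: i; j; i], [:: j; i; j]).

Fixpoint word_step (rules : seq (seq nat * seq nat)) (u : seq nat) :=
  if [seq r <- rules | prefix r.1 u] is r :: _ then
    Some (r.2 ++ drop (size r.1) u)
  else if u is x :: u' then omap (cons x) (word_step rules u') else None.

Fixpoint word_nf rules fuel u :=
  if fuel is fuel'.+1 then
    if word_step rules u is Some v then word_nf rules fuel' v else u
  else u.

Definition f4_mul_term (t s : f4term) : seq f4term :=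
  let u := t.2 ++ s.2 in
  if t.1 && s.1 then [:: (false, u); (true, u)] else [:: (t.1 || s.1, u)].

Definition f4_add (p q : seq f4term) := foldr f4_toggle q p.

Definition f4_mul (p q : seq f4term) :=
  foldr (fun t acc => foldr (fun s => f4_add (f4_mul_term t s)) acc q) [::] p.

Definition f4_nf rules fuel (p : seq f4term) :=
  foldr (fun t => f4_toggle (t.1, word_nf rules fuel t.2)) [::] p.

Fixpoint f4_terms rules fuel (e : f4expr) : seq f4term :=
  match e with
  | F4var i => [:: (false, [:: i])]
  | F4zero => [::]
  | F4one => [:: (false, [::])]
  | F4omega => [:: (true, [::])]
  | F4add e1 e2 => f4_add (f4_terms rules fuel e1) (f4_terms rules fuel e2)
  | F4mul e1 e2 =>
      f4_nf rules fuel (f4_mul (f4_terms rules fuel e1) (f4_terms rules fuel e2))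
  end.

Section Soundness.
Variables (B : pzRingType) (w : B) (env : seq B).
Hypotheses (char2 : (1 + 1 : B) = 0) (ww : w * w = 1 + w).
Hypothesis wC : forall x, w * x = x * w.

Fixpoint f4_eval (e : f4expr) : B :=
  match e with
  | F4var i => env`_i
  | F4zero => 0
  | F4one => 1
  | F4omega => w
  | F4add e1 e2 => f4_eval e1 + f4_eval e2
  | F4mul e1 e2 => f4_eval e1 * f4_eval e2
  end.

Definition weval (u : seq nat) : B := \prod_(i <- u) env`_i.
Definition teval (t : f4term) : B := (if t.1 then w else 1) * weval t.2.
Definition peval (p : seq f4term) : B := \sum_(t <- p) teval t.

Definition rules_sound (rules : seq (seq nat * seq nat)) :=
  foldr (fun r P => weval r.1 = weval r.2 /\ P) True rules.

Lemma addrr2 (x : B) : x + x = 0.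
Proof. by rewrite -[x]mul1r -mulrDl char2 mul0r. Qed.

Lemma peval_toggle t p : peval (f4_toggle t p) = teval t + peval p.
Proof.
rewrite /f4_toggle; case: ifP => [tp|_]; last by rewrite /peval big_cons.
by rewrite [in RHS]/peval (perm_big _ (perm_to_rem tp)) big_cons addrA addrr2 add0r.
Qed.

Lemma peval_add p q : peval (f4_add p q) = peval p + peval q.
Proof.
elim: p => [|t p IHp] /=; first by rewrite /peval big_nil add0r.
by rewrite peval_toggle IHp /peval big_cons addrA.
Qed.

Lemma weval_cat u v : weval (u ++ v) = weval u * weval v.
Proof. exact: big_cat. Qed.

Lemma peval_mul_term t s : peval (f4_mul_term t s) = teval t * teval s.
Proof.
rewrite /f4_mul_term /peval /teval.
case: t s => [[] u] [[] v] /=; rewrite ?big_cons !big_nil /= weval_cat ?addr0.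
- by rewrite -mulrDl -ww -!mulrA; congr (w * _); rewrite !mulrA wC.
- by rewrite mul1r mulrA.
- by rewrite mul1r !mulrA wC.
- by rewrite !mul1r.
Qed.

Lemma peval_mul p q : peval (f4_mul p q) = peval p * peval q.
Proof.
elim: p => [|t p IHp]; first by rewrite /peval big_nil mul0r.
rewrite {2}/peval big_cons mulrDl -/(peval p) -IHp.
rewrite -[LHS]/(peval (foldr (fun s => f4_add (f4_mul_term t s)) (f4_mul p q) q)).
move: (f4_mul p q) => acc {IHp}.
elim: q => [|s q IHq] /=; first by rewrite {2}/peval big_nil mulr0 add0r.
by rewrite peval_add IHq peval_mul_term {3}/peval big_cons mulrDr addrA.
Qed.

Lemma word_step_sound rules u v :
  rules_sound rules -> word_step rules u = Some v -> weval u = weval v.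
Proof.
move=> rs.
have rule_sound r : r \in rules -> weval r.1 = weval r.2.
  elim: (rules) rs => //= r' rules' IH [er /IH{}IH].
  by rewrite inE => /predU1P[->|/IH].
have step u' r s : [seq r <- rules | prefix r.1 u'] = r :: s ->
    weval u' = weval (r.2 ++ drop (size r.1) u').
  move=> def; have: r \in [seq r <- rules | prefix r.1 u'].
    by rewrite def mem_head.
  rewrite mem_filter => /andP[/prefixP[t ->] /rule_sound er].
  by rewrite drop_size_cat // !weval_cat er.
have unfold u' : word_step rules u' =
    if [seq r <- rules | prefix r.1 u'] is r :: _ then
      Some (r.2 ++ drop (size r.1) u')
    else if u' is x :: u'' then omap (cons x) (word_step rules u'') else None.
  by case: u'.
elim: u v => [|x u IHu] v; rewrite unfold;
  case def: [seq _ <- _ | _] => [|r s] //; try by case=> <-; exact: step def.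
case: word_step IHu => // u' /(_ _ erefl) e [<-].
by rewrite /weval !big_cons -!/(weval _) e.
Qed.

Lemma word_nf_sound rules fuel u :
  rules_sound rules -> weval (word_nf rules fuel u) = weval u.
Proof.
move=> rs; elim: fuel u => //= fuel IH u.
by case def: word_step => [v|//]; rewrite IH (word_step_sound rs def).
Qed.

Lemma f4_nf_sound rules fuel p :
  rules_sound rules -> peval (f4_nf rules fuel p) = peval p.
Proof.
move=> rs; elim: p => //= t p IHp.
by rewrite peval_toggle IHp /teval word_nf_sound // /peval big_cons.
Qed.

Lemma f4_terms_sound rules fuel e :
  rules_sound rules -> peval (f4_terms rules fuel e) = f4_eval e.
Proof.
move=> rs; elim: e => [i||||e1 IH1 e2 IH2|e1 IH1 e2 IH2] /=.
- by rewrite /peval big_seq1 /teval /weval big_seq1 mul1r.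
- by rewrite /peval big_nil.
- by rewrite /peval big_seq1 /teval /weval big_nil mul1r.
- by rewrite /peval big_seq1 /teval /weval big_nil mulr1.
- by rewrite peval_add IH1 IH2.
- by rewrite f4_nf_sound // peval_mul IH1 IH2.
Qed.

(** The check is sound for any list of valid rules, terminating and confluent or not: an incomplete
    normal form or exhausted fuel can only make it fail. In characteristic 2 a difference is a sum,
    hence [F4add]. *)
Lemma f4_ring_correct rules fuel e1 e2 :
  rules_sound rules ->
  nilp (f4_terms rules fuel (F4add e1 e2)) -> f4_eval e1 = f4_eval e2.
Proof.
move=> rs /nilP nf0; have := f4_terms_sound fuel (F4add e1 e2) rs.
rewrite nf0 /peval big_nil /= => /esym e0.
by apply/(addIr (f4_eval e2)); rewrite e0 addrr2.
Qed.

End Soundness.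

Ltac f4_index x l :=
  match l with
  | x :: _ => constr:(0%N)
  | _ :: ?l' => let n := f4_index x l' in constr:(n.+1)
  end.

Ltac f4_power e n :=
  match n with
  | 0%N => constr:(F4one)
  | 1%N => constr:(e)
  | ?m.+1 => let r := f4_power e m in constr:(F4mul e r)
  end.

Ltac f4_reify w l x :=
  match x with
  | w => constr:(F4omega)
  | GRing.add ?a ?b =>
      let ea := f4_reify w l a in let eb := f4_reify w l b in
      constr:(F4add ea eb)
  | GRing.mul ?a ?b =>
      let ea := f4_reify w l a in let eb := f4_reify w l b in
      constr:(F4mul ea eb)
  | GRing.exp ?a ?n => let ea := f4_reify w l a in f4_power ea n
  | @GRing.zero _ => constr:(F4zero)
  | @GRing.one _ => constr:(F4one)
  | _ => let i := f4_index x l in constr:(F4var i)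
  end.

(* Decides an identity between elements of a ring of characteristic 2 with a
   central cube root of unity w, modulo word rewriting rules. *)
Ltac f4_ring w l rules char2 ww wC tac :=
  match goal with |- ?a = ?b =>
    let ea := f4_reify w l a in
    let eb := f4_reify w l b in
    change (f4_eval w l ea = f4_eval w l eb);
    apply: (@f4_ring_correct _ w l char2 ww wC rules 100);
      [rewrite /= /weval ?big_cons ?big_nil /=; tac | by vm_compute]
  end.

(** * Elements of order 3 in characteristic 2: eigenprojections, the main relation, [cross3] *)

Section CubicElements.
Variables (B : pzRingType) (w : B).
Hypotheses (char2 : (1 + 1 : B) = 0) (ww : w * w = 1 + w).
Hypothesis wC : forall x, w * x = x * w.

(** The orderings of the three cube roots of unity, with w^2 written 1 + w. Case analysis turns the
    roots into polynomials in w, which [f4_ring] can handle. *)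
Inductive all_roots : B -> B -> B -> Prop :=
| AllRoots012 : all_roots 1 w (1 + w)
| AllRoots021 : all_roots 1 (1 + w) w
| AllRoots102 : all_roots w 1 (1 + w)
| AllRoots120 : all_roots w (1 + w) 1
| AllRoots201 : all_roots (1 + w) 1 w
| AllRoots210 : all_roots (1 + w) w 1.

(* The projection onto the kernel of x - c when x^3 = c^3 = 1. *)
Definition eigenproj (c x : B) := 1 + c * c * x + c * x * x.

(* a b^-1 + b a^-1 + a^-1 b + b^-1 a when a^3 = b^3 = 1. *)
Definition quat_rel (a b : B) := a * b * b + b * a * a + a * a * b + b * b * a.

(** For a^3 = b^3 = 1 this is a b^-1 + a^-1 b. The main relation is [cross a b] + [cross b a], so it
    says that [cross] is symmetric. For commuting elements [cross3] is the Vandermonde product (a +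
    b)(b + c)(a + c). *)
Definition cross (a b : B) := a * b * b + a * a * b.

Definition cross3 (a b c : B) := cross a b + cross b c + cross a c.

Ltac solve_rules := rewrite ?mulr1 ?mulrA; do ?split => //.
Ltac f4 l rules :=
  rewrite /cross3 /quat_rel /cross /eigenproj; f4_ring w l rules char2 ww wC solve_rules.

Lemma all_rootsC al be ga : all_roots al be ga -> all_roots be al ga.
Proof. by case; constructor. Qed.

Lemma all_rootsR al be ga : all_roots al be ga -> all_roots be ga al.
Proof. by case; constructor. Qed.

Lemma all_roots_central al be ga x : all_roots al be ga -> al * x = x * al.
Proof. by case; rewrite ?mulrDl ?mulrDr ?mul1r ?mulr1 ?wC. Qed.

Lemma eigenproj_sum al be ga x : all_roots al be ga ->
  eigenproj al x + eigenproj be x + eigenproj ga x = 1.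
Proof. by case; f4 [:: x] (Nil (seq nat * seq nat)). Qed.

Lemma eigenproj_dec al be ga x u : all_roots al be ga ->
  u = eigenproj al x * u + eigenproj be x * u + eigenproj ga x * u.
Proof.
move=> r; rewrite -(mulrDl (eigenproj al x)).
by rewrite -(mulrDl (eigenproj al x + eigenproj be x)) eigenproj_sum ?mul1r.
Qed.

Lemma eigenproj_decr al be ga x u : all_roots al be ga ->
  u = u * eigenproj al x + u * eigenproj be x + u * eigenproj ga x.
Proof. by move=> r; rewrite -2!mulrDr eigenproj_sum ?mulr1. Qed.

Lemma eigenproj_eq0r x a :
  (forall al be ga, all_roots al be ga -> x * eigenproj al a = 0) -> x = 0.
Proof.
move=> xa; rewrite -[LHS]mulr1 -(eigenproj_sum a AllRoots012) 2!mulrDr.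
by rewrite (xa _ _ _ AllRoots012) (xa _ _ _ AllRoots120) (xa _ _ _ AllRoots201) !addr0.
Qed.

Lemma eigenproj_orth al be ga x : all_roots al be ga -> x * x * x = 1 ->
  eigenproj al x * eigenproj be x = 0.
Proof. by move=> r x3; case: r; f4 [:: x] [:: cube_rule 0]. Qed.

Lemma eigenprojM al be ga x : all_roots al be ga -> x * x * x = 1 ->
  x * eigenproj al x = al * eigenproj al x.
Proof. by move=> r x3; case: r; f4 [:: x] [:: cube_rule 0]. Qed.

(** The braid relation applied to u gives al be (al + be) u = 0, and the scalar is al be ga = 1. *)
Lemma braid_eigen0 al be ga a b u : all_roots al be ga ->
  a * b * a = b * a * b -> a * u = al * u -> b * u = be * u -> u = 0.
Proof.
move=> r ab au bu.
have pull y v : y * (al * v) = al * (y * v).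
  by rewrite mulrA -(all_roots_central _ r) -mulrA.
have pull' y v : y * (be * v) = be * (y * v).
  by rewrite mulrA -(all_roots_central _ (all_rootsC r)) -mulrA.
have abu : a * b * a * u = al * be * al * u.
  by rewrite -!mulrA au (pull b) bu (pull a) (pull' a) au !mulrA.
have bau : b * a * b * u = be * al * be * u.
  by rewrite -!mulrA bu (pull' a) au (pull' b) (pull b) bu !mulrA.
have : (al * be * al + be * al * be) * u = 0.
  by rewrite mulrDl -abu ab bau (addrr2 char2).
have -> : al * be * al + be * al * be = 1.
  by case: r {au bu pull pull' abu bau}; f4 (Nil B) (Nil (seq nat * seq nat)).
by rewrite mul1r.
Qed.

(** Between p_ga(a) and p_al(a) the main relation becomes (ga + al) b^2 + (ga^2 + al^2) b = be b^2 +
    be^2 b, which is p_be(b) - 1; the constant contributes p_ga(a) p_al(a) = 0. *)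
Lemma quat_rel_eigenproj al be ga a b : all_roots al be ga ->
  a * a * a = 1 -> b * b * b = 1 -> quat_rel a b = 0 ->
  eigenproj ga a * eigenproj be b * eigenproj al a = 0.
Proof.
move=> r a3 b3 ab.
rewrite -[RHS](mul0r (eigenproj al a)) -(mulr0 (eigenproj ga a)) -ab.
by case: r; f4 [:: a; b] [:: cube_rule 0; cube_rule 1].
Qed.

Lemma quat_relC a b : quat_rel b a = quat_rel a b.
Proof. f4 [:: a; b] (Nil (seq nat * seq nat)). Qed.

Lemma crossC a b : quat_rel a b = 0 -> cross b a = cross a b.
Proof.
move=> ab; rewrite -[RHS]addr0 -ab; f4 [:: a; b] (Nil (seq nat * seq nat)).
Qed.

Lemma eigenproj_id al be ga a u : all_roots al be ga ->
  a * u = al * u -> eigenproj al a * u = u.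
Proof.
move=> r au; transitivity (u + al * a * (a * u + al * u)).
  by case: r {au}; f4 [:: a; u] (Nil (seq nat * seq nat)).
by rewrite au (addrr2 char2) mulr0 addr0.
Qed.

Lemma eigenproj_eq0 al be ga a u : all_roots al be ga -> a * a * a = 1 ->
  a * u = al * u -> eigenproj be a * u = 0.
Proof.
move=> r a3 au; rewrite -(eigenproj_id r au) mulrA.
by rewrite (eigenproj_orth (all_rootsC r)) // mul0r.
Qed.

Lemma eigenproj_eigen al be ga a u : all_roots al be ga -> a * a * a = 1 ->
  eigenproj be a * u = 0 -> eigenproj ga a * u = 0 -> a * u = al * u.
Proof.
move=> r a3 ube uga; have : u = eigenproj al a * u.
  by rewrite {1}(eigenproj_dec a u r) ube uga !addr0.
by move=> ->; rewrite !mulrA (eigenprojM r a3).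
Qed.

(** Split u into its components p_al(b) u and p_be(b) u. By [quat_rel_eigenproj] the first has no
    be-part under a and the second no al-part; as u itself is a ga-eigenvector, both components are
    ga-eigenvectors of a. Being eigenvectors of b for another root, they vanish by
    [braid_eigen0]. *)
Lemma quat_rel_eigen0 al be ga a b u : all_roots al be ga ->
  a * a * a = 1 -> b * b * b = 1 -> a * b * a = b * a * b -> quat_rel a b = 0 ->
  a * u = ga * u -> eigenproj ga b * u = 0 -> u = 0.
Proof.
move=> r a3 b3 aba ab au bu.
have r' := all_rootsC r.
have def_u : u = eigenproj al b * u + eigenproj be b * u.
  by rewrite {1}(eigenproj_dec b u r) bu addr0.
have [ua ub] : eigenproj be a * (eigenproj al b * u) = 0 /\
               eigenproj al a * (eigenproj be b * u) = 0.
  have idu := eigenproj_id (all_rootsR (all_rootsR r)) au.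
  rewrite -idu !mulrA (@quat_rel_eigenproj ga al be) ?mul0r //;
    last exact: all_rootsR (all_rootsR r).
  rewrite (@quat_rel_eigenproj ga be al) ?mul0r //.
  exact: all_rootsR (all_rootsR r').
have vanish x y : all_roots x y ga -> eigenproj y a * (eigenproj x b * u) = 0 ->
    eigenproj x a * (eigenproj y b * u) = 0 ->
    u = eigenproj x b * u + eigenproj y b * u -> eigenproj x b * u = 0.
  move=> s yx xy def; apply: (@braid_eigen0 ga x y a b).
  - exact: all_rootsR (all_rootsR s).
  - exact: aba.
  - apply: (@eigenproj_eigen ga x y) => //; first exact: all_rootsR (all_rootsR s).
    have := eigenproj_eq0 (all_rootsR (all_rootsR s)) a3 au.
    by rewrite {1}def mulrDr xy addr0.
  - by rewrite !mulrA (eigenprojM s b3).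
rewrite def_u (vanish al be) // (vanish be al) ?addr0 //.
by rewrite addrC.
Qed.

Lemma eigenproj_conj al be ga x a a' : all_roots al be ga -> x * a = a' * x ->
  eigenproj al a' * x = x * eigenproj al a.
Proof.
by move=> r xa; case: r; f4 [:: x; a; a'] [:: ([:: 0; 1], [:: 2; 0])]%N.
Qed.

Lemma eigenproj_comm al be ga be' al' ga' a b :
  all_roots al be ga -> all_roots al' be' ga' -> a * b = b * a ->
  eigenproj al a * eigenproj al' b = eigenproj al' b * eigenproj al a.
Proof.
by move=> r r' ab; case: r; case: r'; f4 [:: a; b] [:: comm_rule 1 0].
Qed.

(** Since a and c commute, it is enough to multiply on the right by the products p(a) p(c). For
    equal roots the result is a multiple of the main relation; for distinct roots al, ga there
    remains p_be(b) p_al(a) p_ga(c), which [chain0] shows to be 0. *)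
Lemma cross3_chain a b c :
  a * a * a = 1 -> b * b * b = 1 -> c * c * c = 1 -> a * c = c * a ->
  a * b * a = b * a * b -> b * c * b = c * b * c ->
  quat_rel a b = 0 -> quat_rel b c = 0 -> cross3 a b c = 0.
Proof.
move=> a3 b3 c3 ac aba bcb ab bc.
have ba : quat_rel b a = 0 by rewrite quat_relC.
have cb : quat_rel c b = 0 by rewrite quat_relC.
have chain0 al be ga : all_roots al be ga ->
    eigenproj be b * eigenproj al a * eigenproj ga c = 0.
  move=> r; have r1 := all_rootsR r; have r2 := all_rootsR r1.
  have r' := all_rootsC r; have r1' := all_rootsR r'; have r2' := all_rootsR r1'.
  have acC := eigenproj_comm r r2 ac.
  set x := _ * _ * _.
  have xga : eigenproj ga a * x = 0.
    by rewrite /x !mulrA (quat_rel_eigenproj r) ?mul0r.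
  have xal : eigenproj al c * x = 0.
    by rewrite /x -mulrA acC !mulrA (quat_rel_eigenproj r2') ?mul0r.
  (* Between p_be(a) p_be(c) and p_al(a) p_ga(c) the two main relations become p_ga(b) and p_al(b)
     up to constants, which vanish there; their sum is p_be(b), again up to a constant. *)
  have xbb : eigenproj be c * (eigenproj be a * x) = 0.
    transitivity
      (eigenproj be a * eigenproj be c * quat_rel a b *
         eigenproj al a * eigenproj ga c +
       eigenproj be a * eigenproj be c * quat_rel b c *
         eigenproj al a * eigenproj ga c).
      by rewrite /x; case: r {r1 r2 r' r1' r2' acC x xga xal}; f4 [:: a; b; c]
        [:: cube_rule 0; cube_rule 1; cube_rule 2; comm_rule 2 0].
    by rewrite ab bc !(mulr0, mul0r) addr0.
  (* This element is a ga-eigenvector of c and is killed by p_ga(b), so [quat_rel_eigen0] applies to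
     the pair (c, b). Then x is an al-eigenvector of a and a be-eigenvector of b, hence 0. *)
  have xbe : eigenproj be a * x = 0.
    apply: (quat_rel_eigen0 r c3 b3) => //.
      apply: (eigenproj_eigen r2 c3) => //.
      by rewrite mulrA -(eigenproj_comm r1 r ac) -mulrA xal mulr0.
    transitivity (eigenproj ga b * x); last first.
      by rewrite /x !mulrA (eigenproj_orth r2') ?mul0r.
    rewrite {2}(eigenproj_dec a x r) xga addr0 mulrDr.
    rewrite [X in X + _](_ : _ = 0) ?add0r //.
    by rewrite /x !mulrA (quat_rel_eigenproj r') ?mul0r.
  apply: (braid_eigen0 r aba); first exact: (eigenproj_eigen r a3).
  by rewrite /x !mulrA (eigenprojM r1 b3).
have split al be ga : all_roots al be ga ->
    (cross3 a b c * eigenproj al a * eigenproj al c = 0) *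
    (cross3 a b c * eigenproj al a * eigenproj ga c = 0).
  move=> r; split; last rewrite -[RHS](chain0 _ _ _ r);
  [transitivity (quat_rel a b * eigenproj al a * eigenproj al c)
  |transitivity (quat_rel a b * eigenproj al a * eigenproj ga c +
                eigenproj be b * eigenproj al a * eigenproj ga c)].
  - by case: r; f4 [:: a; b; c]
        [:: cube_rule 0; cube_rule 1; cube_rule 2; comm_rule 2 0].
  - by rewrite ab !mul0r.
  - by case: r; f4 [:: a; b; c]
        [:: cube_rule 0; cube_rule 1; cube_rule 2; comm_rule 2 0].
  - by rewrite ab !mul0r add0r.
apply: (eigenproj_eq0r (a := a)) => al be ga r.
apply: (eigenproj_eq0r (a := c)) => al' be' ga' r'.
case: r; case: r';
  first [by apply: (split _ _ _ _).1; constructor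
        |by apply: (split _ _ _ _).2; constructor].
Qed.

(** [cross3] is a coboundary, so the two vanishing values give x = [cross3 a b d] = [cross3 a c d].
    The first form commutes with d. In the second, a commutes with c and d, and multiplying by
    p_al(a) p_ga(d) leaves p_be(c) p_al(a) p_ga(d): an eigenvector of c and d for different
    roots. *)
Lemma cross3_far a b c d :
  a * a * a = 1 -> c * c * c = 1 -> d * d * d = 1 ->
  a * c = c * a -> a * d = d * a -> b * d = d * b -> c * d * c = d * c * d ->
  cross3 a b c = 0 -> cross3 b c d = 0 -> cross3 a b d = 0.
Proof.
move=> a3 c3 d3 ac ad bd cdc abc bcd.
have def_x : cross3 a b d = cross3 a c d.
  transitivity (cross3 a b c + cross3 b c d + cross3 a c d); last by rewrite abc bcd !add0r.
  by f4 [:: a; b; c; d] (Nil (seq nat * seq nat)).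
have dx : d * cross3 a b d = cross3 a b d * d.
  by f4 [:: a; b; d] [:: comm_rule 2 0; comm_rule 2 1].
move: (cross3 a b d) def_x dx => x def_x dx.
have split al be ga : all_roots al be ga ->
    (x * eigenproj al a * eigenproj al d = 0) *
    (x * eigenproj al a * eigenproj ga d = 0).
  move=> r; split.
    by rewrite def_x; case: r; f4 [:: a; c; d]
        [:: cube_rule 0; cube_rule 1; cube_rule 2; comm_rule 2 0; comm_rule 1 0].
  have r1 := all_rootsR r; have r2 := all_rootsR r1.
  have def_y : x * eigenproj al a * eigenproj ga d =
      eigenproj be c * eigenproj al a * eigenproj ga d.
    by rewrite def_x; case: r {r1 r2}; f4 [:: a; c; d]
      [:: cube_rule 0; cube_rule 1; cube_rule 2; comm_rule 2 0; comm_rule 1 0].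
  apply: (@braid_eigen0 be ga al c d) => //.
    by rewrite def_y !mulrA (eigenprojM r1 c3).
  rewrite -!mulrA (eigenproj_comm r r2) // !mulrA dx -(mulrA x d) (eigenprojM r2 d3).
  by rewrite !mulrA (all_roots_central _ r2).
apply: (eigenproj_eq0r (a := a)) => al be ga r.
apply: (eigenproj_eq0r (a := d)) => al' be' ga' r'.
case: r; case: r';
  first [by apply: (split _ _ _ _).1; constructor
        |by apply: (split _ _ _ _).2; constructor].
Qed.

Lemma quat_rel_conj (x y a b a' b' : B) : x * y = 1 ->
  x * a = a' * x -> x * b = b' * x -> quat_rel a b = 0 -> quat_rel a' b' = 0.
Proof.
move=> xy xa xb ab.
have -> : quat_rel a' b' = quat_rel a' b' * x * y by rewrite -mulrA xy mulr1.
have -> : quat_rel a' b' * x = x * quat_rel a b.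
  by f4 [:: a; b; x; a'; b']
    [:: ([:: 2; 0], [:: 3; 2]); ([:: 2; 1], [:: 4; 2])]%N.
by rewrite ab mulr0 mul0r.
Qed.

(** Conjugation by abc carries the pair (a, b) to (b, c). *)
Lemma quat_rel_shift (a b c : B) :
  a * a * a = 1 -> b * b * b = 1 -> c * c * c = 1 -> a * c = c * a ->
  a * b * a = b * a * b -> b * c * b = c * b * c ->
  quat_rel a b = 0 -> quat_rel b c = 0.
Proof.
move=> a3 b3 c3 ac aba bcb.
apply: (@quat_rel_conj (a * b * c) (c * c * b * b * a * a)).
- by f4 [:: a; b; c] [:: cube_rule 0; cube_rule 1; cube_rule 2].
- by f4 [:: a; b; c] [:: comm_rule 2 0; braid_rule 0 1].
- by f4 [:: a; b; c] [:: comm_rule 2 0; braid_rule 1 2].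
Qed.

Section Chain.
Variables (n : nat) (s : nat -> B).
Let inR i := (0 < i < n)%N.
Hypothesis s3 : forall i, inR i -> s i * s i * s i = 1.
Hypothesis s_far : forall i j, inR i -> inR j -> (i + 2 <= j)%N -> s i * s j = s j * s i.
Hypothesis s_braid : forall i, inR i -> inR i.+1 ->
  s i * s i.+1 * s i = s i.+1 * s i * s i.+1.
Hypothesis s_quat : forall i, inR i -> inR i.+1 -> quat_rel (s i) (s i.+1) = 0.

Lemma cross_genC i j : inR i -> inR j -> cross (s i) (s j) = cross (s j) (s i).
Proof.
wlog le_ij : i j / (i <= j)%N => [th|] Ri Rj.
  by have [/th->|/ltnW/th->] := leqP i j.
case: (ltngtP i j) le_ij => // [lt_ij _|-> //].
have [lt_ij2|] := ltnP i.+1 j.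
  have ij : s i * s j = s j * s i by rewrite s_far // addn2.
  by f4 [:: s i; s j] [:: comm_rule 1 0].
move=> le_ji; have def_j : j = i.+1 by apply/eqP; rewrite eqn_leq le_ji.
by rewrite def_j in Rj *; rewrite (crossC (a := s i)) // s_quat.
Qed.

Lemma cross3_rev i j k : inR i -> inR j -> inR k ->
  cross3 (s i) (s j) (s k) = cross3 (s k) (s j) (s i).
Proof.
move=> Ri Rj Rk; rewrite /cross3 (cross_genC Ri Rj) (cross_genC Rj Rk).
by rewrite (cross_genC Ri Rk) [X in X + _]addrC.
Qed.

(** Induction on k - i. A gap between j and k is reduced by [cross3_far] through k - 1, a gap
    between i and j by its mirror image through i + 1; without gaps the three generators form a
    chain. *)
Lemma cross3_lt_gen i j k : inR i -> inR k -> (i < j < k)%N ->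
  cross3 (s i) (s j) (s k) = 0.
Proof.
have [m] := ubnP (k - i)%N; elim: m i j k => // m IHm i j k.
rewrite ltnS => le_m Ri Rk /andP[ij jk].
have R x : (i <= x <= k)%N -> inR x.
  case/andP: Ri Rk => i_gt0 _ /andP[_ k_lt] /andP[ix xk].
  by rewrite /inR (leq_trans i_gt0) ?(leq_ltn_trans xk).
have comm x y : inR x -> inR y -> (x + 2 <= y)%N || (y + 2 <= x)%N ->
    s x * s y = s y * s x.
  by move=> Rx Ry /orP[]/s_far-> //.
have Rj : inR j by rewrite R // ltnW // ltnW.
have [jk2|] := ltnP j.+1 k.
  have def_k : k = k.-1.+1 by rewrite prednK // (leq_trans _ jk).
  have jk1 : (j < k.-1)%N by rewrite -ltnS -def_k.
  have Rk1 : inR k.-1 by rewrite R // leq_pred -ltnS -def_k (ltn_trans ij).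
  apply: (@cross3_far (s i) (s j) (s k.-1) (s k)); try by exact: s3.
  - by apply: s_far => //; rewrite addn2 (leq_ltn_trans ij).
  - by apply: s_far => //; rewrite addn2 (leq_ltn_trans ij) // ltnW.
  - by apply: s_far => //; rewrite addn2.
  - by have := s_braid Rk1; rewrite -def_k; apply.
  - apply: IHm; rewrite ?ij //; apply: leq_trans le_m.
    by rewrite ltn_sub2r ?(ltn_trans ij) // [ltnRHS]def_k.
  - apply: IHm => //; last by rewrite jk1 [ltnRHS]def_k /=.
    by apply: leq_trans le_m; rewrite ltn_sub2l // (ltn_trans ij).
move=> kj; have def_k : k = j.+1 by apply/eqP; rewrite eqn_leq kj.
have [ij2|] := ltnP i.+1 j.
  have Ri1 : inR i.+1 by rewrite R // leqnSn (ltn_trans ij jk).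
  have ij1 : (i.+1 < j)%N by [].
  have e : cross3 (s k) (s j) (s i) = 0.
    apply: (@cross3_far (s k) (s j) (s i.+1) (s i)); try by exact: s3.
    - by symmetry; apply: s_far => //; rewrite addn2 (leq_ltn_trans ij1 jk).
    - by symmetry; apply: s_far => //; rewrite addn2 (ltn_trans ij1 jk).
    - by symmetry; apply: s_far => //; rewrite addn2.
    - by symmetry; apply: s_braid.
    - rewrite cross3_rev // IHm ?ij1 //.
      by apply: leq_trans le_m; rewrite ltn_sub2l // (ltn_trans ij).
    - rewrite cross3_rev // IHm ?leqnn //.
      by apply: leq_trans le_m; rewrite ltn_sub2r // (ltn_trans ij).
  by rewrite -e; apply: cross3_rev.
move=> ji; have def_j : j = i.+1 by apply/eqP; rewrite eqn_leq ji.
rewrite def_k def_j in Rj Rk *.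
apply: cross3_chain; try by [exact: s3 | exact: s_braid | exact: s_quat].
by apply: s_far => //; rewrite addn2.
Qed.

Lemma cross3_gen i j k : inR i -> inR j -> inR k ->
  cross3 (s i) (s j) (s k) = 0.
Proof.
have cross0 x : inR x -> cross (s x) (s x) = 0 by move=> _; exact: (addrr2 char2).
have C12 x y z : inR x -> inR y -> inR z ->
    cross3 (s x) (s y) (s z) = cross3 (s y) (s x) (s z).
  move=> Rx Ry Rz; by rewrite /cross3 (cross_genC Rx Ry) [LHS]addrAC.
move=> Ri Rj Rk.
have [ij|ij] := eqVneq i j.
  by rewrite /cross3 ij cross0 // add0r (addrr2 char2).
have [jk|jk] := eqVneq j k.
  by rewrite /cross3 jk cross0 // addr0 (addrr2 char2).
have [ik|ik] := eqVneq i k.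
  by rewrite /cross3 ik cross0 // addr0 (cross_genC Rk Rj) (addrr2 char2).
wlog lt_ij : i j ij jk ik Ri Rj / (i < j)%N => [th|].
  have [/th->//|le_ji] := ltnP i j; rewrite C12 // th // 1?eq_sym //.
  by rewrite ltn_neqAle eq_sym ij.
have [lt_jk|le_kj] := ltnP j k; first by rewrite cross3_lt_gen // lt_ij.
rewrite cross3_rev // C12 // cross3_rev //.
have lt_kj : (k < j)%N by rewrite ltn_neqAle eq_sym jk.
have [lt_ik|le_ki] := ltnP i k; first by rewrite cross3_lt_gen // lt_ik.
by rewrite C12 // cross3_lt_gen // lt_ij ltn_neqAle eq_sym ik le_ki.
Qed.

End Chain.

(** This and the next two identities are the lower left entries of the cube, commutation and braid
    relations for the triangular matrices with diagonal (a, r) and lower left entry a^2 + r^2. The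
    condition [cross3 r a b] = 0 is exactly what commutation requires. *)
Lemma affine_cube (r a : B) : r * r * r = 1 -> a * a * a = 1 ->
  (a * a + r * r) * a * a + r * (a * a + r * r) * a + r * r * (a * a + r * r) = 0.
Proof. by move=> r3 a3; f4 [:: r; a] [:: cube_rule 0; cube_rule 1]. Qed.

Lemma affine_comm (r a b : B) : a * b = b * a -> cross3 r a b = 0 ->
  (a * a + r * r) * b + r * (b * b + r * r) =
  (b * b + r * r) * a + r * (a * a + r * r).
Proof.
move=> ab rab; rewrite -[RHS]addr0 -rab.
by f4 [:: r; a; b] [:: comm_rule 2 1].
Qed.

Lemma affine_braid (r a b : B) : r * r * r = 1 -> a * a * a = 1 -> b * b * b = 1 ->
  a * b * a = b * a * b -> quat_rel a b = 0 -> cross3 r a b = 0 ->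
  (a * a + r * r) * b * a + r * (b * b + r * r) * a + r * r * (a * a + r * r) =
  (b * b + r * r) * a * b + r * (a * a + r * r) * b + r * r * (b * b + r * r).
Proof.
move=> r3 a3 b3 aba ab rab.
have bbab : b * b * a * b = a * b * a * a.
  by rewrite -[LHS]mulr1 -a3 -!mulrA (mulrA a b) !(mulrA _ a (a * a)) aba !mulrA b3 mul1r.
rewrite -[RHS]addr0 -(mulr0 a) -ab -[RHS]addr0 -(mul0r (a + b)) -rab.
by f4 [:: r; a; b] [:: cube_rule 0; cube_rule 1; cube_rule 2; ([:: 2; 2; 1; 2], [:: 1; 2; 1; 1])].
Qed.

(** For a central t with t (r - a) = r^-1 - a^-1 this is t (p_c(r) - p_c(a)): write r^2 - a^2 = r (r
    - a) + (r - a) a to get t (r^2 - a^2) = [cross r a]. *)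
Definition base_change c r a := c * c * (r * r + a * a) + c * cross r a.

Lemma base_change_sum (r a : B) :
  base_change 1 r a + base_change w r a + base_change (1 + w) r a = 0.
Proof. by rewrite /base_change; f4 [:: r; a] (Nil (seq nat * seq nat)). Qed.

(** The al-component of the induction step from x to x h in [theta_base_change]. *)
Lemma base_changeM al be ga r a h : all_roots al be ga ->
  r * r * r = 1 -> a * a * a = 1 -> h * h * h = 1 -> cross3 r a h = 0 ->
  base_change al r a * h + eigenproj al a * (h * h + a * a) =
  eigenproj al r * (h * h + r * r) + al * base_change al r a.
Proof.
move=> rt r3 a3 h3 rah; rewrite -[RHS]addr0 -[X in _ = _ + X](mulr0 (al * al)) -rah.
rewrite -[RHS]addr0 -[X in _ = _ + X](mul0r h) -[X in _ = _ + X * h](mulr0 al) -rah.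
rewrite /base_change; case: rt; f4 [:: r; a; h] [:: cube_rule 0; cube_rule 1; cube_rule 2].
Qed.

Lemma braid_quaternion (a b : B) :
  a * a * a = 1 -> b * b * b = 1 -> a * b * a = b * a * b ->
  let u := a * b * a in
  (u * u * u * u = 1) *
  (quat_rel a b * (b * b * a) = 1 + u + u * u + u * u * u).
Proof.
move=> a3 b3 ab u.
have twist (x y : B) : x * x * x = 1 -> y * y * y = 1 -> x * y * x = y * x * y ->
    y * y * x * y = x * y * x * x.
  move=> x3 y3 xy; rewrite -[LHS]mulr1 -x3 -!mulrA (mulrA x y) !(mulrA _ x (x * x)).
  by rewrite xy !mulrA y3 mul1r.
have bbab := twist a b a3 b3 ab; have aaba := twist b a b3 a3 (esym ab).
have uu : u * u = b * b * a * b * b * a by rewrite /u !mulrA -bbab.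
have uu' : u * u = a * a * b * a * a * b by rewrite /u ab !mulrA -aaba.
have u4 : u * u * u * u = 1.
  rewrite -(mulrA (u * u)) {1}uu uu'.
  by f4 [:: a; b] [:: cube_rule 0; cube_rule 1].
(* The four terms of [quat_rel a b] multiplied by b^2 a are u, b a^2 b^2 a, 1 and b^2 a b^2 a; the
   second is u^-1 and the last is u^2. *)
have u_inv : b * a * a * b * b * a = u * u * u.
  have xu : b * a * a * b * b * a * u = 1.
    rewrite /u ab; transitivity (b * a * a * (b * b * a * b) * a * b).
      by f4 [:: a; b] (Nil (seq nat * seq nat)).
    by rewrite bbab; f4 [:: a; b] [:: cube_rule 0; cube_rule 1].
  rewrite -[LHS]mulr1 -u4; transitivity (b * a * a * b * b * a * u * (u * u * u)).
    by move: (u) => v; rewrite !mulrA.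
  by rewrite xu mul1r.
split=> //; rewrite -u_inv uu /u.
by f4 [:: a; b] [:: cube_rule 0; cube_rule 1].
Qed.

Lemma quat_rel_eigen al be ga a b : all_roots al be ga ->
  quat_rel a b = al * al * (a * eigenproj al b + b * eigenproj al a +
                            eigenproj al a * b + eigenproj al b * a).
Proof. by case; f4 [:: a; b] (Nil (seq nat * seq nat)). Qed.

Lemma eigenproj_add al be ga x y : all_roots al be ga ->
  eigenproj al x + eigenproj al y = al * al * (x + y) + al * (x * x + y * y).
Proof. by case; f4 [:: x; y] (Nil (seq nat * seq nat)). Qed.

Lemma eigenproj_shiftl al be ga x y : all_roots al be ga -> x * x * x = 1 ->
  x * eigenproj al y + al * eigenproj al y =
  (x + al) * (eigenproj al y + eigenproj al x).
Proof. by move=> r x3; case: r; f4 [:: x; y] [:: cube_rule 0]. Qed.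

Lemma eigenproj_shiftr al be ga x y : all_roots al be ga -> x * x * x = 1 ->
  eigenproj al y * x + al * eigenproj al y =
  (eigenproj al y + eigenproj al x) * (x + al).
Proof. by move=> r x3; case: r; f4 [:: x; y] [:: cube_rule 0]. Qed.

(** The value of [cusp al] at p_al(a) + p_al(r), once [theta] has been computed. *)
Lemma eigenproj_diff (al be ga r a : B) : all_roots al be ga ->
  r * r * r = 1 -> a * a * a = 1 ->
  (r + al) * (al * al * (a * a + r * r) + al * ((a * a + r * r) * a + r * (a * a + r * r))) +
  (r * r + al * al) * (al * al * (a + r) + al * (a * a + r * r)) = 0.
Proof.
by move=> rt r3 a3; case: rt; f4 [:: r; a] [:: cube_rule 0; cube_rule 1].
Qed.

End CubicElements.

(** * Linear extension to the group algebra, and modules over it given by operators *)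

Section UnbundledLinear.
Variables (k : comNzRingType) (U V : lmodType k) (f : U -> V).
Hypothesis f_lin : linear f.

Lemma unbundled_linearD x y : f (x + y) = f x + f y.
Proof. by rewrite -[x]scale1r f_lin !scale1r. Qed.

Lemma unbundled_linear0 : f 0 = 0.
Proof. by apply: (addIr (f 0)); rewrite -unbundled_linearD !add0r. Qed.

Lemma unbundled_linearZ c x : f (c *: x) = c *: f x.
Proof. by rewrite -[c *: x]addr0 f_lin unbundled_linear0 addr0. Qed.

End UnbundledLinear.

Section LinearExtension.
Variables (k : comNzRingType) (G : groupType) (V : lmodType k) (f : G -> V).

Definition galg_lift (x : group_algebra k G) : V :=
  \sum_(g <- msupp x) x@_g *: f g.

Lemma galg_liftEw (d : {fset G}) (x : group_algebra k G) :
  (msupp x `<=` d)%fset -> galg_lift x = \sum_(g <- d) x@_g *: f g.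
Proof.
move=> le; rewrite /galg_lift (big_fset_incl _ le) // => g _ /mcoeff_outdom ->.
exact: scale0r.
Qed.

Lemma galg_lift_linear : linear galg_lift.
Proof.
move=> c x y; pose d := (msupp x `|` msupp y)%fset.
rewrite (@galg_liftEw d x) ?fsubsetUl // (@galg_liftEw d y) ?fsubsetUr //.
rewrite (@galg_liftEw d); last first.
  apply: fsubset_trans (msuppD_le _ _) _; apply: fsetSU; exact: msuppZ_le.
rewrite scaler_sumr -big_split; apply: eq_bigr => g _ /=.
by rewrite mcoeffD mcoeffZ scalerDl scalerA.
Qed.

Lemma galg_lift_of g : galg_lift (galg_of k g) = f g.
Proof. by rewrite (galg_liftEw msuppU_le) big_seq_fset1 mcoeffUU scale1r. Qed.

End LinearExtension.

Lemma galg_ind (k : comNzRingType) (G : groupType) (P : group_algebra k G -> Prop) :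
  (forall c x, P x -> P (c *: x)) -> (forall x y, P x -> P y -> P (x + y)) ->
  (forall g, P (galg_of k g)) -> forall x, P x.
Proof.
move=> PZ PD Pg x; rewrite (galgE x).
elim: (enum_fset (msupp x)) => [|g s IHs].
  by rewrite big_nil -(scale0r (galg_of k 1%g)); apply: PZ.
by rewrite big_cons; apply: PD => //; apply: PZ.
Qed.

Lemma galg_ofM (k : comNzRingType) (G : groupType) (g h : G) :
  galg_of k (g * h)%g = galg_of k g * galg_of k h.
Proof. by rewrite -galg_mul_of. Qed.

Lemma galg_of1 (k : comNzRingType) (G : groupType) : galg_of k (1%g : G) = 1.
Proof. by []. Qed.

Section GammaInduction.
Variable n : nat.

Lemma pres_gen_letter (i : gamma_index n) b :
  \pi_(gamma n) [:: (i, b)] =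
  (if b then sgen n (val i) * sgen n (val i) else sgen n (val i))%g.
Proof.
case: b; last by rewrite sgen_val.
apply: (mulgI (sgen n (val i))); rewrite mulgA.
transitivity (1%g : gamma n).
  rewrite sgen_val /pres_gen pi_presM; apply/pi_presP.
  exact: (WordInv _ (i, false)).
by have := sgen_cube n (val i); rewrite !expgS expg0 mulg1 mulgA.
Qed.

(** Positive words are enough, since an inverse letter is the square of the letter. *)
Lemma gamma_ind (P : gamma n -> Prop) : P 1%g ->
  (forall i g, (0 < i < n)%N -> P g -> P (sgen n i * g)%g) -> forall g, P g.
Proof.
move=> P1 PM; elim/quotW; elim=> [//|[i b] u IHu].
rewrite -cat1s -pi_presM pres_gen_letter.
have Ri : (0 < val i < n)%N := valP i.
by case: b; rewrite -?mulgA; do ?apply: (PM _ _ Ri); exact: IHu.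
Qed.

Lemma gamma_indr (P : gamma n -> Prop) : P 1%g ->
  (forall i g, (0 < i < n)%N -> P g -> P (g * sgen n i)%g) -> forall g, P g.
Proof.
move=> P1 PM; elim/quotW; elim/last_ind => [//|u [i b] IHu].
rewrite -cats1 -pi_presM pres_gen_letter.
have Ri : (0 < val i < n)%N := valP i.
by case: b; rewrite ?mulgA; do ?apply: (PM _ _ Ri); exact: IHu.
Qed.

End GammaInduction.

Section GammaModule.
Variables (k : comNzRingType) (n : nat) (V : lmodType k) (T : nat -> V -> V).
Hypothesis T_lin : forall i, linear (T i).
Hypothesis T_cube : forall i v, (0 < i < n)%N -> T i (T i (T i v)) = v.
Hypothesis T_far : forall i j v, (0 < i < n)%N -> (0 < j < n)%N ->
  (i + 2 <= j)%N -> T i (T j v) = T j (T i v).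
Hypothesis T_braid : forall i v, (0 < i < n)%N -> (0 < i.+1 < n)%N ->
  T i (T i.+1 (T i v)) = T i.+1 (T i (T i.+1 v)).

(** The inverse of T is taken to be its square, so that no invertible operators have to be
    supplied. *)
Definition letter_act (l : gamma_index n * bool) v :=
  if l.2 then T (val l.1) (T (val l.1) v) else T (val l.1) v.

Lemma word_act_eq u u' : word_eq (@gamma_rel n) u u' ->
  forall v, foldr letter_act v u = foldr letter_act v u'.
Proof.
have R (x : gamma_index n) : (0 < sval x < n)%N := valP x.
elim=> {u u'} //.
- move=> u u' [i j /= ij|i j /= ij|i] v; rewrite /= /letter_act /=.
  + by case/orP: ij => ij; [rewrite T_far | rewrite -T_far].
  + by have := @T_braid (sval i) v (R i); rewrite -ij; apply.
  + by rewrite T_cube.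
- by move=> [i []] v; rewrite /= /letter_act /= T_cube.
- by move=> u u' x y _ IHu _ IHx v; rewrite !foldr_cat IHx IHu.
- by move=> u u' x _ IHu _ IHx v; rewrite IHu.
Qed.

Lemma gamma_module : exists rho : group_algebra k (gamma n) -> V -> V,
  [/\ forall v, linear (rho^~ v), forall v, rho 1 v = v &
      forall i x v, (0 < i < n)%N ->
        rho (galg_of k (sgen n i) * x) v = T i (rho x v)].
Proof.
pose act (g : gamma n) v := foldr letter_act v (repr g).
have [rho [rho_lin rhoE]] : exists rho : group_algebra k (gamma n) -> V -> V,
    (forall v, linear (rho^~ v)) /\ forall g v, rho (galg_of k g) v = act g v.
  exists (fun x v => galg_lift (act^~ v) x).
  by split=> [v|g v]; [exact: galg_lift_linear | exact: galg_lift_of].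
exists rho; split=> // [v|i x v Ri].
  by rewrite -galg_of1 rhoE /act (word_act_eq (repr_pi_pres _ _)).
elim/galg_ind: x => [c x IHx|x y IHx IHy|g].
- rewrite -scalerAr !(unbundled_linearZ (rho_lin v)) IHx.
  by rewrite (unbundled_linearZ (T_lin i)).
- rewrite (mulrDr (galg_of k (sgen n i)) x y).
  rewrite (unbundled_linearD (rho_lin v) (_ * x)) (unbundled_linearD (rho_lin v) x).
  rewrite (unbundled_linearD (T_lin i) (rho x v)).
  exact: (congr2 +%R IHx IHy).
- rewrite -galg_ofM !rhoE /act.
  rewrite (@word_act_eq _ ((Sub i Ri, false) :: repr g)) //.
  apply/pi_presP; rewrite reprK -cat1s -pi_presM reprK.
  by rewrite (pres_gen_letter (Sub i Ri : gamma_index n) false).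
Qed.

End GammaModule.

(* The universal property of the group algebra of Gamma_n, generated by the
   elements s 1, ..., s n.-1. *)
Record cubic_algebra (k : comNzRingType) (n : nat) (R : algType k) (s : nat -> R) : Prop := {
  cubic_cube : forall i, (0 < i < n)%N -> s i * s i * s i = 1;
  cubic_far : forall i j, (0 < i < n)%N -> (0 < j < n)%N -> (i + 2 <= j)%N ->
    s i * s j = s j * s i;
  cubic_braid : forall i, (0 < i < n)%N -> (0 < i.+1 < n)%N ->
    s i * s i.+1 * s i = s i.+1 * s i * s i.+1;
  cubic_ind : forall P : R -> Prop, (forall c x, P x -> P (c *: x)) ->
    (forall x y, P x -> P y -> P (x + y)) -> P 1 ->
    (forall i x, (0 < i < n)%N -> P x -> P (s i * x)) -> forall x, P x;
  cubic_indr : forall P : R -> Prop, (forall c x, P x -> P (c *: x)) ->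
    (forall x y, P x -> P y -> P (x + y)) -> P 1 ->
    (forall i x, (0 < i < n)%N -> P x -> P (x * s i)) -> forall x, P x;
  cubic_module : forall (V : lmodType k) (T : nat -> V -> V),
    (forall i, linear (T i)) ->
    (forall i v, (0 < i < n)%N -> T i (T i (T i v)) = v) ->
    (forall i j v, (0 < i < n)%N -> (0 < j < n)%N -> (i + 2 <= j)%N ->
       T i (T j v) = T j (T i v)) ->
    (forall i v, (0 < i < n)%N -> (0 < i.+1 < n)%N ->
       T i (T i.+1 (T i v)) = T i.+1 (T i (T i.+1 v))) ->
    exists rho : R -> V -> V,
      [/\ forall v, linear (rho^~ v), forall v, rho 1 v = v &
          forall i x v, (0 < i < n)%N -> rho (s i * x) v = T i (rho x v)]
}.

Lemma gamma_cubic_algebra (k : comNzRingType) (n : nat) :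
  @cubic_algebra k n (group_algebra k (gamma n)) (fun i => galg_of k (sgen n i)).
Proof.
split.
- move=> i _; rewrite -2!galg_ofM -galg_of1; congr galg_of.
  by have := sgen_cube n i; rewrite !expgS expg0 mulg1 mulgA.
- by move=> i j Ri Rj ij; rewrite -2!galg_ofM sgen_far // ij.
- move=> i /andP[i_gt0 _] /andP[_ i1]; rewrite -4!galg_ofM; congr galg_of.
  exact: sgen_braid.
- move=> P PZ PD P1 PM; apply: galg_ind => //.
  by elim/gamma_ind => // i g Ri Pg; rewrite galg_ofM; apply: PM.
- move=> P PZ PD P1 PM; apply: galg_ind => //.
  by elim/gamma_indr => // i g Ri Pg; rewrite galg_ofM; apply: PM.
- exact: gamma_module.
Qed.

(** * A free module of dimension n! with the universal property of the regular Hecke module *)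

Record hecke_operators (k : comNzRingType) (sg rho : k) (n : nat) (V : lmodType k)
    (T : nat -> V -> V) : Prop := HeckeOperators {
  hecke_lin : forall i, linear (T i);
  hecke_quad : forall i x, (0 < i < n)%N -> T i (T i x) = sg *: T i x + rho *: x;
  hecke_far : forall i j x, (0 < i < n)%N -> (0 < j < n)%N -> (i + 2 <= j)%N ->
    T i (T j x) = T j (T i x);
  hecke_braid : forall i x, (0 < i < n)%N -> (0 < i.+1 < n)%N ->
    T i (T i.+1 (T i x)) = T i.+1 (T i (T i.+1 x))
}.

(* The left regular module of the Hecke algebra with quadratic relation
   T_i^2 = sg T_i + rho. *)
Record hecke_regular (k : comNzRingType) (sg rho : k) (n : nat) (V : lmodType k)
    (T : nat -> V -> V) (v : V) : Prop := HeckeRegular {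
  regular_operators : hecke_operators sg rho n T;
  regular_cyclic : forall P : V -> Prop, (forall c x, P x -> P (c *: x)) ->
    (forall x y, P x -> P y -> P (x + y)) -> P v ->
    (forall i x, (0 < i < n)%N -> P x -> P (T i x)) -> forall x, P x;
  regular_universal : forall (W : lmodType k) (S : nat -> W -> W) (w : W),
    hecke_operators sg rho n S -> exists psi : V -> W,
      [/\ linear psi, psi v = w &
          forall i x, (0 < i < n)%N -> psi (T i x) = S i (psi x)]
}.

Lemma linear_comp (k : comNzRingType) (U V W : lmodType k) (f : V -> W) (g : U -> V) :
  linear f -> linear g -> linear (f \o g).
Proof. by move=> fl gl c x y /=; rewrite gl fl. Qed.

Section HeckeInduction.
Variables (k : comNzRingType) (sg rho : k) (n : nat).
Variables (V : lmodType k) (T : nat -> V -> V) (v : V).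
Hypothesis V_regular : hecke_regular sg rho n T v.
Let TP := regular_operators V_regular.

(* The induced module is the direct sum of the X_p V for p <= n, where
   X_p = T_(p+1) ... T_n. *)
Definition induced := {ffun 'I_n.+1 -> V}.
HB.instance Definition _ := GRing.Lmodule.on induced.

Definition single (p : nat) (x : V) : induced :=
  [ffun r : 'I_n.+1 => if r == p :> nat then x else 0].

(** Coordinates of the rules T_i X_p = X_p T_(i-1) for p < i - 1, T_i X_(i-1) = sg X_(i-1) + rho
    X_i, T_i X_i = X_(i-1), and T_i X_p = X_p T_i for p > i. Since X_n = 1, the generator is
    [single n v]. *)
Definition induced_op (i : nat) (m : induced) : induced :=
  [ffun r : 'I_n.+1 =>
    if (r < i.-1)%N then T i.-1 (m r)
    else if r == i.-1 :> nat then sg *: m r + m (inord i)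
    else if r == i :> nat then rho *: m (inord i.-1)
    else T i (m r)].

Lemma induced_op_linear i : linear (induced_op i).
Proof.
move=> c x y; apply/ffunP=> r; rewrite !ffunE.
do 3?case: ifP => _; rewrite ?(hecke_lin TP) //.
  by rewrite !scalerDr addrACA !scalerA mulrC.
by rewrite scalerDr !scalerA mulrC.
Qed.

Lemma single_linear p : linear (single p).
Proof.
by move=> c x y; apply/ffunP=> r; rewrite !ffunE; case: ifP; rewrite ?scaler0 ?addr0.
Qed.

Lemma single_sum (m : induced) : m = \sum_(r < n.+1) single r (m r).
Proof.
apply/ffunP=> r; rewrite sum_ffunE (bigD1 r) //= ffunE eqxx big1 ?addr0 // => r' ne.
by rewrite ffunE val_eqE eq_sym (negbTE ne).
Qed.

Lemma hecke_op0 i : T i 0 = 0.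
Proof. exact: unbundled_linear0 (hecke_lin TP i). Qed.

Lemma op_single_lt i p x : (p < i < n)%N ->
  induced_op i.+1 (single p x) = single p (T i x).
Proof.
move=> pin; apply/ffunP=> r; rewrite !ffunE /= inordK ?ltnS; last by lia.
rewrite inordK; last by lia.
by do ![case: ifP => ?]; rewrite ?hecke_op0 ?scaler0 ?addr0 //; lia.
Qed.

Lemma op_single_eq i x : (i < n)%N ->
  induced_op i.+1 (single i x) = sg *: single i x + rho *: single i.+1 x.
Proof.
move=> lt_in; apply/ffunP=> r; rewrite !ffunE /= inordK ?ltnS; last by lia.
rewrite inordK; last by lia.
by do ![case: ifP => ?]; rewrite ?hecke_op0 ?scaler0 ?addr0 ?add0r //; lia.
Qed.

Lemma op_single_eqS i x : (i < n)%N ->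
  induced_op i.+1 (single i.+1 x) = single i x.
Proof.
move=> lt_in; apply/ffunP=> r; rewrite !ffunE /= inordK ?ltnS; last by lia.
rewrite inordK; last by lia.
by do ![case: ifP => ?]; rewrite ?hecke_op0 ?scaler0 ?addr0 ?add0r //; lia.
Qed.

Lemma op_single_gt i p x : (0 < i < p)%N -> (p <= n)%N ->
  induced_op i (single p x) = single p (T i x).
Proof.
move=> ip pn; apply/ffunP=> r; rewrite !ffunE /= inordK ?ltnS; last by lia.
rewrite inordK; last by lia.
by do ![case: ifP => ?]; rewrite ?hecke_op0 ?scaler0 ?addr0 ?add0r //; lia.
Qed.

Lemma induced_linear_eq (W : lmodType k) (f g : induced -> W) :
  linear f -> linear g -> (forall p x, (p <= n)%N -> f (single p x) = g (single p x)) ->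
  forall m, f m = g m.
Proof.
move=> fl gl fg m; rewrite (single_sum m).
have sumE (h : induced -> W) (I : Type) (r : seq I) F : linear h ->
    h (\sum_(i <- r) F i) = \sum_(i <- r) h (F i).
  move=> hl; apply: (big_morph h); first exact: unbundled_linearD hl.
  exact: unbundled_linear0 hl.
rewrite !sumE //; apply: eq_bigr => i _; apply: fg; exact: leq_ord.
Qed.

Let opD i := unbundled_linearD (induced_op_linear i).
Let opZ i := unbundled_linearZ (induced_op_linear i).
Let sD p := unbundled_linearD (single_linear p).
Let sZ p := unbundled_linearZ (single_linear p).

Lemma induced_quad i m : (0 < i < n.+1)%N ->
  induced_op i (induced_op i m) = sg *: induced_op i m + rho *: m.
Proof.
case: i => // i /= lt_in; move: m; apply: induced_linear_eq => [||p x pn].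
- exact: linear_comp (induced_op_linear _) (induced_op_linear _).
- move=> c x y; rewrite induced_op_linear !scalerDr !scalerA addrACA.
  by rewrite (mulrC sg) (mulrC rho).
- have [pi|ip|->] := ltngtP p i.
  + by rewrite !op_single_lt ?pi // (hecke_quad TP) ?sD ?sZ //; lia.
  + have [ip'|ip'] := ltnP i.+1 p.
      by rewrite !op_single_gt // (hecke_quad TP) ?sD ?sZ //; lia.
    have -> : p = i.+1 by lia.
    by rewrite op_single_eqS // op_single_eq.
  + by rewrite op_single_eq // opD !opZ op_single_eqS // op_single_eq.
Qed.

Lemma induced_far i h m : (0 < i < n.+1)%N -> (0 < h < n.+1)%N -> (i + 2 <= h)%N ->
  induced_op i (induced_op h m) = induced_op h (induced_op i m).
Proof.
case: i h => // i [//|h] /= lt_in lt_hn ih; move: m.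
apply: induced_linear_eq => [||p x pn];
  try exact: linear_comp (induced_op_linear _) (induced_op_linear _).
have [pi|ip|->] := ltngtP p i.
- rewrite !op_single_lt //; try lia.
  by rewrite (hecke_far TP) //; lia.
- have [ip'|ip'] := ltnP i.+1 p; last first.
    have -> : p = i.+1 by lia.
    by rewrite (op_single_eqS _ lt_in) !(@op_single_lt h) ?op_single_eqS //; lia.
  have [ph|hp|->] := ltngtP p h.
  + rewrite !(@op_single_lt h) ?(@op_single_gt i.+1) ?(@op_single_lt h) //; try lia.
    by rewrite (hecke_far TP) //; lia.
  + have [hp'|hp'] := ltnP h.+1 p; last first.
      have -> : p = h.+1 by lia.
      by rewrite (op_single_eqS _ lt_hn) !(@op_single_gt i.+1) ?op_single_eqS //; lia.
    rewrite !op_single_gt //; try lia.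
    by rewrite (hecke_far TP) //; lia.
  + by rewrite (op_single_eq _ lt_hn) opD !opZ !(@op_single_gt i.+1) ?op_single_eq //; lia.
- by rewrite (op_single_eq _ lt_in) opD !opZ !(@op_single_lt h) ?op_single_eq //; lia.
Qed.

Lemma induced_braid i m : (0 < i < n.+1)%N -> (0 < i.+1 < n.+1)%N ->
  induced_op i (induced_op i.+1 (induced_op i m)) =
  induced_op i.+1 (induced_op i (induced_op i.+1 m)).
Proof.
case: i => // i /= lt_in lt_i1n; move: m.
apply: induced_linear_eq => [||p x pn];
  try exact: linear_comp (induced_op_linear _)
    (linear_comp (induced_op_linear _) (induced_op_linear _)).
have A0 y : induced_op i.+1 (single i y) = sg *: single i y + rho *: single i.+1 y.
  exact: op_single_eq.
have A1 y : induced_op i.+1 (single i.+1 y) = single i y by exact: op_single_eqS.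
have A2 y : induced_op i.+1 (single i.+2 y) = single i.+2 (T i.+1 y).
  by apply: op_single_gt; lia.
have B0 y : induced_op i.+2 (single i y) = single i (T i.+1 y).
  by apply: op_single_lt; lia.
have B1 y : induced_op i.+2 (single i.+1 y) = sg *: single i.+1 y + rho *: single i.+2 y.
  by apply: op_single_eq; lia.
have B2 y : induced_op i.+2 (single i.+2 y) = single i.+1 y.
  by apply: op_single_eqS; lia.
have [pi|ip|->] := ltngtP p i.
- rewrite !op_single_lt //; try lia.
  by rewrite (hecke_braid TP) //; lia.
- have [ip'|ip'] := ltnP i.+2 p.
    rewrite !op_single_gt //; try lia.
    by rewrite (hecke_braid TP) //; lia.
  have [->|p_neq] := eqVneq p i.+1.
    by rewrite B1 !opD !opZ !A1 A2 B2 !B0 A0.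
  have -> : p = i.+2 by lia.
  by rewrite A2 !B2 !A1 B0.
(* On X_i x one side contains sg X_i T^2 x and the other sg^2 X_i T x + sg rho X_i x, where T is
   operator i + 1 of V: they agree by the quadratic relation in V. *)
- rewrite A0 B0 A0 !opD !opZ B0 B1 !opD !opZ A1 A2 A0 B0 B1 (hecke_quad TP) ?sD ?sZ; last by lia.
  by rewrite !scalerDr [LHS]addrACA !scalerA (mulrC rho sg).
Qed.

Lemma induced_operators : hecke_operators sg rho n.+1 induced_op.
Proof.
split; [exact: induced_op_linear | | exact: induced_far | exact: induced_braid].
by move=> i x; exact: induced_quad.
Qed.

Lemma induced_cyclic (P : induced -> Prop) : (forall c x, P x -> P (c *: x)) ->
  (forall x y, P x -> P y -> P (x + y)) -> P (single n v) ->
  (forall i x, (0 < i < n.+1)%N -> P x -> P (induced_op i x)) -> forall x, P x.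
Proof.
move=> PZ PD Pv PT.
have Pn x : P (single n x).
  elim/(regular_cyclic V_regular): x => [c x Px|x y Px Py||i x Ri Px] //.
  - by rewrite sZ; exact: PZ.
  - by rewrite sD; exact: PD.
  - by rewrite -op_single_gt //; apply: PT => //; lia.
have Pp d x : (d <= n)%N -> P (single (n - d) x).
  elim: d x => [|d IHd] x le_dn; first by rewrite subn0.
  (* Descend from p = n by X_(p-1) = T_p X_p. *)
  rewrite -op_single_eqS; last by lia.
  apply: PT; first by lia.
  have -> : (n - d.+1).+1 = (n - d)%N by lia.
  by apply: IHd; lia.
move=> m; rewrite (single_sum m).
have P0 : P 0 by rewrite -(scale0r (single n v)); exact: PZ.
apply: (big_ind P) => // i _.
have -> : i = (n - (n - i))%N :> nat by have := leq_ord i; lia.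
by apply: Pp; lia.
Qed.

Section Universal.
Variables (W : lmodType k) (S : nat -> W -> W) (w : W).
Hypothesis SP : hecke_operators sg rho n.+1 S.

(** The action of X_p on W. *)
Definition shift_op p (x : W) := foldr S x (iota p.+1 (n - p)).

Lemma shift_opE p x : (p < n)%N -> shift_op p x = S p.+1 (shift_op p.+1 x).
Proof. by move=> pn; rewrite /shift_op -subnSK. Qed.

Lemma shift_op_linear p : linear (shift_op p).
Proof.
move=> c x y; rewrite /shift_op; elim: (iota _ _) => //= i s ->.
exact: hecke_lin SP _ _ _ _.
Qed.

Lemma shift_op_gt i p x : (0 < i < p)%N -> (p <= n)%N ->
  S i (shift_op p x) = shift_op p (S i x).
Proof.
move=> ip pn; have [d def_p] : exists d, p = (n - d)%N by exists (n - p)%N; lia.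
elim: d p def_p ip pn => [|d IHd] p def_p ip pn.
  by rewrite /shift_op def_p subn0 subnn.
have [lt_pn|le_np] := ltnP p n; last first.
  by rewrite /shift_op (eqP (_ : n - p == 0)%N) // subn_eq0.
rewrite !(shift_opE _ lt_pn) -IHd; try lia.
by rewrite (hecke_far SP) //; lia.
Qed.

Lemma shift_op_lt i p x : (p < i < n)%N ->
  S i.+1 (shift_op p x) = shift_op p (S i x).
Proof.
move=> pin; have [d def_i] : exists d, i = (p + d).+1 by exists (i - p.+1)%N; lia.
elim: d p def_i pin => [|d IHd] p def_i pin.
  have {}def_i : i = p.+1 by lia.
  have [lt_pn lt_p1n] : (p < n /\ p.+1 < n)%N by lia.
  rewrite !(shift_opE _ lt_pn) !(shift_opE _ lt_p1n).
  have [Ri Ri1] : (0 < i < n.+1 /\ 0 < i.+1 < n.+1)%N by lia.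
  by rewrite -def_i -(hecke_braid SP _ Ri Ri1) (@shift_op_gt i) //; lia.
have lt_pn : (p < n)%N by lia.
rewrite !(shift_opE _ lt_pn) -(IHd p.+1); try lia.
by rewrite -(hecke_far SP) //; lia.
Qed.

Lemma induced_universal : exists psi : induced -> W,
  [/\ linear psi, psi (single n v) = w &
      forall i x, (0 < i < n.+1)%N -> psi (induced_op i x) = S i (psi x)].
Proof.
have SP' : hecke_operators sg rho n S.
  case: SP => lin quad far braid; split=> //.
  - by move=> i x Ri; apply: quad; lia.
  - by move=> i j x Ri Rj ij; apply: far => //; lia.
  - by move=> i x Ri Ri1; apply: braid; lia.
have [psi [psi_lin psi_v psiT]] := regular_universal V_regular w SP'.
(* Frobenius reciprocity: psi is equivariant for the first n - 1 operators, and the image of X_r x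
   is forced to be X_r psi(x). *)
pose Psi (m : induced) := \sum_(r < n.+1) shift_op r (psi (m r)).
have Psi_lin : linear Psi.
  move=> c x y; rewrite /Psi scaler_sumr -big_split; apply: eq_bigr => r _ /=.
  by rewrite !ffunE psi_lin shift_op_linear.
have Psi_single p x : (p <= n)%N -> Psi (single p x) = shift_op p (psi x).
  move=> pn; rewrite /Psi (bigD1 (Ordinal (pn : p < n.+1)%N)) //= ffunE eqxx.
  rewrite big1 ?addr0 // => r ne; rewrite ffunE ifN;
    last by apply: contraNneq ne => rp; apply/eqP/val_inj.
  by rewrite (unbundled_linear0 psi_lin) (unbundled_linear0 (shift_op_linear _)).
exists Psi; split=> //.
  by rewrite Psi_single // /shift_op subnn.
case=> // i x /= lt_in; move: x.
have SD := unbundled_linearD Psi_lin; have SZ := unbundled_linearZ Psi_lin.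
apply: induced_linear_eq => [||p x pn].
- exact: linear_comp Psi_lin (induced_op_linear _).
- exact: linear_comp (hecke_lin SP _) Psi_lin.
have [pi|ip|->] := ltngtP p i.
- by rewrite op_single_lt ?pi // !Psi_single // psiT ?shift_op_lt ?pi //; lia.
- have [ip'|ip'] := ltnP i.+1 p.
    by rewrite op_single_gt // !Psi_single // psiT ?shift_op_gt //; lia.
  have -> : p = i.+1 by lia.
  by rewrite op_single_eqS // !Psi_single 1?shift_opE //; lia.
- rewrite op_single_eq // SD !SZ !Psi_single; try lia.
  by rewrite shift_opE // (hecke_quad SP).
Qed.

End Universal.

Lemma induced_regular : hecke_regular sg rho n.+1 induced_op (single n v).
Proof.
split; [exact: induced_operators | exact: induced_cyclic |].
by move=> W S w; exact: induced_universal.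
Qed.

End HeckeInduction.

(** Each induction step multiplies the dimension by n + 1, starting from k for n = 0. This supplies
    the dimension of the Hecke algebra without a basis indexed by permutations. *)
Lemma exists_hecke_regular (k : fieldType) (sg rho : k) n :
  exists (V : vectType k) (T : nat -> V -> V) (v : V),
    \dim {:V} = n`! /\ hecke_regular sg rho n T v.
Proof.
elim: n => [|n [V [T [v [dimV V_regular]]]]].
  exists k^o, (fun _ => id), 1; split; first by rewrite dimvf.
  split.
  - by split=> // i x /andP[].
  - by move=> P PZ PD P1 _ x; rewrite -[x]mulr1; exact: PZ.
  - move=> W S w _; exists (fun c => c *: w); split=> [c x y||i x /andP[]//].
      by rewrite scalerDl scalerA.
    by rewrite scale1r.
exists {ffun 'I_n.+1 -> V}, (induced_op sg rho T), (single n n v); split.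
  by rewrite dimvf /dim /= card_ord factS -dimV dimvf.
exact: induced_regular.
Qed.

(** * The intersection of the three ideals is the ideal of the main relation *)

Lemma all_roots_morph (B B' : pzRingType) (f : {rmorphism B -> B'}) (w al be ga : B) :
  all_roots w al be ga -> all_roots (f w) (f al) (f be) (f ga).
Proof. by case; rewrite ?rmorphD ?rmorph1; constructor. Qed.

Section Separation.
Variables (k : fieldType) (j : k) (n : nat) (R : algType k) (s : nat -> R).
Hypothesis char2 : (1 + 1 : k) = 0.
Hypothesis jj : j * j = 1 + j.
Hypothesis n_gt2 : (2 < n)%N.
Hypothesis R_cubic : cubic_algebra n s.
Let inR i := (0 < i < n)%N.

Record is_character (c : k) (f : R -> k) : Prop := IsCharacter {
  characterZ_ : forall a x, f (a *: x) = a * f x;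
  characterD_ : forall x y, f (x + y) = f x + f y;
  character1_ : f 1 = 1;
  character_gen_ : forall i x, inR i -> f (s i * x) = c * f x
}.

Lemma all_roots_cube al be ga : all_roots j al be ga -> al * al * al = 1.
Proof.
have jC (x : k) : j * x = x * j by exact: mulrC.
case; by f4_ring j (Nil k) (Nil (seq nat * seq nat)) char2 jj jC ltac:(idtac).
Qed.

Lemma exists_character al be ga : all_roots j al be ga ->
  exists f, is_character al f.
Proof.
move=> /all_roots_cube al3.
have [||||rho [rho_lin rho1 rhoM]] := cubic_module R_cubic (V := k^o)
    (T := fun _ v => al * v).
- by move=> i c u v; rewrite mulrDr scalerAr.
- by move=> i v _; rewrite !mulrA al3 mul1r.
- by [].
- by [].
exists (rho^~ 1); split.
- exact: unbundled_linearZ (rho_lin 1).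
- exact: unbundled_linearD (rho_lin 1).
- exact: rho1.
- by move=> i x; exact: rhoM.
Qed.

(** A classical choice keeps c as the only parameter; the zero default does not occur when c is one
    of the three roots. *)
Definition character (c : k) : R -> k :=
  if pselect (exists f, is_character c f) is left ex then sval (cid ex)
  else fun=> 0.

Section Character.
Variables (al be ga : k).
Hypothesis roots : all_roots j al be ga.

Lemma characterP : is_character al (character al).
Proof.
rewrite /character; case: pselect => [ex|[]]; first by case: cid.
exact: exists_character roots.
Qed.

Lemma characterZ c x : character al (c *: x) = c * character al x.
Proof. by rewrite (characterZ_ characterP). Qed.

Lemma characterD x y : character al (x + y) = character al x + character al y.
Proof. by rewrite (characterD_ characterP). Qed.

Lemma character1 : character al 1 = 1.
Proof. exact: character1_ characterP. Qed.

Lemma character_genl i x : inR i -> character al (s i * x) = al * character al x.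
Proof. exact: character_gen_ characterP _ _. Qed.

Lemma character0 : character al 0 = 0.
Proof. by rewrite -(scale0r 1) characterZ mul0r. Qed.

Lemma characterM x y : character al (x * y) = character al x * character al y.
Proof.
elim/(cubic_ind R_cubic): x => [c x IH|x x' IH IH'||i x Ri IH].
- by rewrite -scalerAl !characterZ IH mulrA.
- by rewrite mulrDl !characterD IH IH' mulrDl.
- by rewrite mul1r character1 mul1r.
- by rewrite -mulrA !character_genl // IH mulrA.
Qed.

Lemma character_gen i : inR i -> character al (s i) = al.
Proof. by move=> Ri; rewrite -[s i]mulr1 character_genl // character1 mulr1. Qed.

Lemma characterC c : character al c%:A = c.
Proof. by rewrite characterZ character1 mulr1. Qed.

Lemma character_eigenproj i c : inR i ->
  character al (eigenproj c%:A (s i)) = eigenproj c al.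
Proof.
by move=> Ri; rewrite !(characterD, characterM, characterC, character_gen) ?character1.
Qed.

Lemma character_ideal (Y : set R) x : ideal_gen Y x ->
  (forall y, Y y -> character al y = 0) -> character al x = 0.
Proof.
move=> Yx Y0; elim: Yx => {x} [x /Y0//||x y _ x0 _ y0|a x _ x0|a x _ x0].
- exact: character0.
- by rewrite characterD x0 y0 addr0.
- by rewrite characterM x0 mulr0.
- by rewrite characterM x0 mul0r.
Qed.

End Character.

Let X : set R := [set quat_rel (s 1) (s 2)]%classic.
Let A : pzRingType := quot_alg X.
Let q : {rmorphism R -> A} := @quot_proj k R X.
Let C : {rmorphism k -> A} := (q \o in_alg R : {rmorphism k -> A}).
Let a i : A := q (s i).

Lemma quot_projZ c (x : R) : q (c *: x) = C c * q x.
Proof. by rewrite -[in LHS](mul1r x) scalerAl rmorphM. Qed.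

Lemma C_central c (x : A) : C c * x = x * C c.
Proof.
have [y <-] := quot_proj_surj x.
rewrite -![quot_proj _ y]/(q y) /C /=.
by rewrite -![quot_proj _ _]/(q _) -!rmorphM mulr_algl mulr_algr.
Qed.

Lemma A_char2 : (1 + 1 : A) = 0.
Proof. by rewrite -(rmorph1 C) -rmorphD char2 rmorph0. Qed.

Lemma A_ww : C j * C j = 1 + C j.
Proof. by rewrite -rmorphM jj rmorphD rmorph1. Qed.

Lemma A_scale c (x : quot_alg X) : c *: x = C c * x :> A.
Proof.
have [y <-] := quot_proj_surj x.
by rewrite -[quot_proj _ y]/(q y) -quot_projZ /= linearZ.
Qed.

Lemma a_cube i : inR i -> a i * a i * a i = 1.
Proof. by move=> Ri; rewrite -!rmorphM (cubic_cube R_cubic) ?rmorph1. Qed.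

Lemma a_far i h : inR i -> inR h -> (i + 2 <= h)%N -> a i * a h = a h * a i.
Proof. by move=> Ri Rh ih; rewrite -!rmorphM (cubic_far R_cubic). Qed.

Lemma a_braid i : inR i -> inR i.+1 ->
  a i * a i.+1 * a i = a i.+1 * a i * a i.+1.
Proof. by move=> Ri Ri1; rewrite -!rmorphM (cubic_braid R_cubic). Qed.

Lemma a_quat i : inR i -> inR i.+1 -> quat_rel (a i) (a i.+1) = 0.
Proof.
case: i => // i; elim: i => [|i IHi] Ri Ri1.
  have : q (quat_rel (s 1) (s 2)) = 0 by apply/quot_proj_eq0; exact: IdealMem.
  by rewrite !(rmorphD, rmorphM).
have Ri0 : inR i.+1 by rewrite /inR /= ltnW // (andP Ri).2.
apply: (quat_rel_shift A_char2 A_ww (C_central j) (a := a i.+1));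
  try by [exact: a_cube | exact: a_braid | exact: IHi].
by apply: a_far => //; rewrite addn2.
Qed.

Lemma a_cross3 i h l : inR i -> inR h -> inR l ->
  cross3 (a i) (a h) (a l) = 0.
Proof.
apply: (cross3_gen A_char2 A_ww (C_central j)) => *;
  [exact: a_cube | exact: a_far | exact: a_braid | exact: a_quat].
Qed.

(* theta r x stands for t x - s_r^(deg x) t in the algebra obtained from A by
   adjoining a central element t with t^3 = 1 and t (s_i - s_r) =
   s_i^-1 - s_r^-1. *)
Record is_theta (r : nat) (f : R -> A) : Prop := IsTheta {
  thetaZ_ : forall c x, f (c *: x) = C c * f x;
  thetaD_ : forall x y, f (x + y) = f x + f y;
  theta1_ : f 1 = 0;
  theta_gen_ : forall i x, inR i ->
    f (s i * x) = (a i * a i + a r * a r) * q x + a r * f x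
}.

(** The triangular matrices of the [affine] identities act on A x A; [theta r x] is the second
    coordinate of x applied to (1, 0), the first being the class of x. *)
Lemma exists_theta r : inR r -> exists f, is_theta r f.
Proof.
move=> Rr; have r3 := a_cube Rr.
pose y i : A := a i * a i + a r * a r.
pose T i (v : quot_alg X * quot_alg X) : quot_alg X * quot_alg X :=
  ((a i * v.1 : A), (y i * v.1 + a r * v.2 : A)).
have [||||rho [rho_lin rho1 rhoM]] := cubic_module R_cubic (T := T).
- move=> i c u v; congr pair => /=.
    by rewrite [RHS]/= mulrDr; congr (_ + _); rewrite !A_scale mulrA -C_central mulrA.
  move: (y i) => z.
  by rewrite [RHS]/= !A_scale !mulrDr !mulrA -!C_central addrACA.
- move=> i [u v] Ri; congr pair => /=; first by rewrite !mulrA a_cube ?mul1r.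
  have := affine_cube A_char2 A_ww (C_central j) r3 (a_cube Ri); rewrite -/(y i).
  move: (y i) => z E; transitivity
    ((z * a i * a i + a r * z * a i + a r * a r * z) * u + a r * a r * a r * v).
    by rewrite !mulrDl !mulrDr !mulrA !addrA.
  by rewrite E r3 mul0r add0r mul1r.
- move=> i h [u v] Ri Rh ih; congr pair => /=; first by rewrite !mulrA a_far.
  have := affine_comm A_char2 A_ww (C_central j) (a_far Ri Rh ih) (a_cross3 Rr Ri Rh).
  rewrite -/(y i) -/(y h); move: (y i) (y h) => z z' E; transitivity
    ((z * a h + a r * z') * u + a r * a r * v).
    by rewrite !mulrDl !mulrDr !mulrA !addrA.
  by rewrite E !mulrDl !mulrDr !mulrA !addrA.
- move=> i [u v] Ri Ri1; congr pair => /=; first by rewrite !mulrA a_braid.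
  have := affine_braid A_char2 A_ww (C_central j) r3 (a_cube Ri) (a_cube Ri1)
    (a_braid Ri Ri1) (a_quat Ri Ri1) (a_cross3 Rr Ri Ri1).
  rewrite -/(y i) -/(y i.+1); move: (y i) (y i.+1) => z z' E; transitivity
    ((z * a i.+1 * a i + a r * z' * a i + a r * a r * z) * u + a r * a r * a r * v).
    by rewrite !mulrDl !mulrDr !mulrA !addrA.
  by rewrite E !mulrDl !mulrDr !mulrA !addrA.
pose v0 : quot_alg X * quot_alg X := (1, 0).
have rho_q x : (rho x v0).1 = q x.
  elim/(cubic_ind R_cubic): x => [c x IH|x x' IH IH'||i x Ri IH].
  - by rewrite (unbundled_linearZ (rho_lin _)) /= IH linearZ.
  - by rewrite (unbundled_linearD (rho_lin _)) /= IH IH' rmorphD.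
  - by rewrite rho1 rmorph1.
  - by rewrite rhoM //= IH rmorphM.
exists (fun x => (rho x v0).2); split.
- by move=> c x; rewrite (unbundled_linearZ (rho_lin _)) /= A_scale.
- by move=> x x'; rewrite (unbundled_linearD (rho_lin _)).
- by rewrite rho1.
- by move=> i x Ri; rewrite rhoM //= rho_q.
Qed.

Definition theta (r : nat) : R -> A :=
  if pselect (exists f, is_theta r f) is left ex then sval (cid ex)
  else fun=> 0.

(* The linear extension of the map sending a group element of degree d to
   s_r^d. *)
Definition base_power (r : nat) (x : R) : A :=
  C (character 1 x) * eigenproj 1 (a r) +
  C (character j x) * eigenproj (C j) (a r) +
  C (character (1 + j) x) * eigenproj (1 + C j) (a r).

Section Theta.
Variable r : nat.
Hypothesis Rr : inR r.

Lemma thetaP : is_theta r (theta r).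
Proof.
rewrite /theta; case: pselect => [ex|[]]; first by case: cid.
exact: exists_theta.
Qed.

Lemma thetaZ c x : theta r (c *: x) = C c * theta r x.
Proof. exact: thetaZ_ thetaP _ _. Qed.

Lemma thetaD x y : theta r (x + y) = theta r x + theta r y.
Proof. exact: thetaD_ thetaP _ _. Qed.

Lemma theta1 : theta r 1 = 0.
Proof. exact: theta1_ thetaP. Qed.

Lemma theta_genl i x : inR i ->
  theta r (s i * x) = (a i * a i + a r * a r) * q x + a r * theta r x.
Proof. exact: theta_gen_ thetaP _ _. Qed.

Lemma theta_gen i : inR i -> theta r (s i) = a i * a i + a r * a r.
Proof.
by move=> Ri; rewrite -[s i]mulr1 theta_genl // theta1 rmorph1 !mulr1 mulr0 addr0.
Qed.

Lemma base_power_genl i x : inR i -> base_power r (s i * x) = a r * base_power r x.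
Proof.
move=> Ri; have [[r0 r1] r2] := (AllRoots012 j, AllRoots120 j, AllRoots201 j).
have e' c al be ga : all_roots (C j) (C al) be ga ->
    C (al * c) * eigenproj (C al) (a r) = a r * (C c * eigenproj (C al) (a r)).
  move=> rt; rewrite mulrC rmorphM -mulrA.
  rewrite -(@eigenprojM _ _ A_char2 A_ww (C_central j) _ _ _ (a r) rt) ?a_cube //.
  by rewrite mulrA C_central -mulrA.
have [C1 C2] := (rmorph1 C, rmorphD C 1 j); rewrite C1 in C2.
rewrite /base_power (character_genl r0) // (character_genl r1) // (character_genl r2) //.
rewrite (mulrDr (a r)) (mulrDr (a r) (_ * _) (_ * _)); congr (_ + _ + _).
- by rewrite -C1; apply: e'; rewrite C1; exact: AllRoots012.
- by apply: e'; exact: AllRoots120.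
- by rewrite -C2; apply: e'; rewrite C2; exact: AllRoots201.
Qed.

(** The cocycle rule t x y - s_r^(deg x + deg y) t = (t x - s_r^(deg x) t) y + s_r^(deg x) (t y -
    s_r^(deg y) t). *)
Lemma thetaM x y : theta r (x * y) = theta r x * q y + base_power r x * theta r y.
Proof.
have [[r0 r1] r2] := (AllRoots012 j, AllRoots120 j, AllRoots201 j).
elim/(cubic_ind R_cubic): x => [c x IH|x x' IH IH'||i x Ri IH].
- rewrite -scalerAl !thetaZ IH /base_power.
  rewrite (characterZ r0) (characterZ r1) (characterZ r2) !rmorphM -!mulrA.
  by rewrite -!mulrDr -!mulrA -mulrDr.
- rewrite mulrDl !thetaD IH IH' (mulrDl (theta r x)) addrACA; congr (_ + _).
  rewrite -(mulrDl (base_power r x)) /base_power; congr (_ * _).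
  rewrite (characterD r0) (characterD r1) (characterD r2) !rmorphD !mulrDl.
  by rewrite addrACA; congr (_ + _); rewrite addrACA.
- rewrite mul1r theta1 mul0r add0r /base_power.
  rewrite (character1 r0) (character1 r1) (character1 r2) rmorph1 !mul1r.
  by rewrite (eigenproj_sum A_char2 A_ww (C_central j) _ (AllRoots012 _)) mul1r.
- rewrite -mulrA !theta_genl // IH rmorphM (mulrDr (a r)) (mulrDl (_ * q x)).
  rewrite !mulrA addrA.
  congr (_ + _ * _); exact: esym (base_power_genl _ Ri).
Qed.

End Theta.

Lemma theta_genr r x i : inR r -> inR i ->
  theta r (x * s i) = theta r x * a i + base_power r x * (a i * a i + a r * a r).
Proof. by move=> Rr Ri; rewrite thetaM // theta_gen. Qed.

(** The two sides differ by (s_r^d - s_t^d) times the central element, d being the degree; this is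
    expanded along the characters. The induction is on the right because there both thetas are
    multiplied by the same s_i. *)
Lemma theta_base_change r t x : inR r -> inR t ->
  theta t x = theta r x +
    (C (character 1 x) * base_change 1 (a r) (a t) +
     C (character j x) * base_change (C j) (a r) (a t) +
     C (character (1 + j) x) * base_change (1 + C j) (a r) (a t)).
Proof.
move=> Rr Rt; have [[r0 r1] r2] := (AllRoots012 j, AllRoots120 j, AllRoots201 j).
elim/(cubic_indr R_cubic): x => [c x IH|x x' IH IH'||i x Ri IH].
- rewrite !thetaZ // IH.
  rewrite (characterZ r0) (characterZ r1) (characterZ r2) !rmorphM -!mulrA.
  by rewrite -!mulrDr.
- rewrite !thetaD // IH IH'.
  rewrite (characterD r0) (characterD r1) (characterD r2) !rmorphD !mulrDl.
  rewrite addrACA; congr (_ + _); rewrite [LHS]addrACA; congr (_ + _).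
  by rewrite [LHS]addrACA.
- rewrite !theta1 // (character1 r0) (character1 r1) (character1 r2) rmorph1.
  by rewrite !mul1r (base_change_sum A_char2 A_ww (C_central j)) addr0.
- rewrite !theta_genr // IH mulrDl -[in RHS]addrA -[LHS]addrA; congr (_ + _).
  rewrite (characterM r0) (characterM r1) (characterM r2).
  rewrite (character_gen r0) ?(character_gen r1) ?(character_gen r2) //.
  have dist (f0 f1 f2 g0 g1 g2 h y : A) :
      (f0 + f1 + f2) * h + (g0 + g1 + g2) * y =
      (f0 * h + g0 * y) + (f1 * h + g1 * y) + (f2 * h + g2 * y).
    by rewrite !mulrDl [LHS]addrACA; congr (_ + _); rewrite addrACA.
  rewrite /base_power -[X in _ = _ + X]mulr1 !dist !mulr1.
  have e al be ga := @base_changeM _ _ A_char2 A_ww (C_central j) al be ga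
    (a r) (a t) (a i).
  have e' c al be ga : all_roots (C j) (C al) be ga ->
      C c * base_change (C al) (a r) (a t) * a i +
      C c * eigenproj (C al) (a t) * (a i * a i + a t * a t) =
      C c * eigenproj (C al) (a r) * (a i * a i + a r * a r) +
      C (c * al) * base_change (C al) (a r) (a t).
    move=> rt; rewrite rmorphM -!mulrA -!mulrDr (e _ be ga) //;
      try exact: a_cube; exact: a_cross3.
  have [C1 C2] := (rmorph1 C, rmorphD C 1 j); rewrite C1 in C2.
  congr (_ + _ + _).
  - have := e' (character 1 x) 1 _ _; rewrite C1 mulr1; apply; exact: AllRoots012.
  - by apply: e'; exact: AllRoots120.
  - by rewrite -C2; apply: e'; rewrite C2; exact: AllRoots201.
Qed.

Definition in_kernel (x : R) :=
  [/\ character 1 x = 0, character j x = 0 & character (1 + j) x = 0].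

Definition cusp (c : k) (x : R) : A :=
  (a 1 + C c) * theta 1 x + (a 1 * a 1 + C c * C c) * q x.

Lemma inR1 : inR 1.
Proof. by rewrite /inR /= ltnW. Qed.

(** On the common kernel both are t x, free of the choice of a base generator. *)
Lemma theta_kernel r x : inR r -> in_kernel x -> theta r x = theta 1 x.
Proof.
move=> Rr [x0 x1 x2]; rewrite (theta_base_change x inR1 Rr) x0 x1 x2 rmorph0.
by rewrite !mul0r !addr0.
Qed.

Lemma theta_kernelM x y : in_kernel x -> theta 1 (x * y) = theta 1 x * q y.
Proof.
move=> [x0 x1 x2]; rewrite (thetaM inR1) /base_power x0 x1 x2 rmorph0.
by rewrite !mul0r !addr0 mul0r addr0.
Qed.

Lemma in_kernelMl y x : in_kernel x -> in_kernel (y * x).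
Proof.
have [[r0 r1] r2] := (AllRoots012 j, AllRoots120 j, AllRoots201 j).
by move=> [x0 x1 x2]; split; rewrite (characterM r0, characterM r1, characterM r2)
  (x0, x1, x2) mulr0.
Qed.

(** Taking s_i itself as base generator makes the term s_i^-1 - s_r^-1 vanish. *)
Lemma theta_kernel_genl i x : inR i -> in_kernel x ->
  theta 1 (s i * x) = a i * theta 1 x.
Proof.
move=> Ri Kx; rewrite -(theta_kernel Ri) ?theta_genl //; last exact: in_kernelMl.
by rewrite (addrr2 A_char2) mul0r add0r theta_kernel.
Qed.

(** With s_i in the place of s_1 in the multiplier, commutation with s_i becomes visible; since i is
    arbitrary, [cusp c] is a bimodule map on the common kernel. *)
Lemma cusp_base c i x : inR i -> in_kernel x ->
  cusp c x = (a i + C c) * theta 1 x + (a i * a i + C c * C c) * q x.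
Proof.
move=> Ri Kx.
have := theta_kernel_genl Ri Kx; rewrite (theta_genl inR1) // /cusp => e.
transitivity ((a i + C c) * theta 1 x + (a i * a i + C c * C c) * q x +
  ((a i * a i + a 1 * a 1) * q x + a 1 * theta 1 x + a i * theta 1 x)).
  move: (theta 1 x) (q x) (C c) (a i) (a 1) => t y b a0 a1.
  by f4_ring (C j) [:: t; y; b; a0; a1] (Nil (seq nat * seq nat))
    A_char2 A_ww (C_central j) ltac:(idtac).
by rewrite e (addrr2 A_char2) addr0.
Qed.

Lemma cusp_genl c i x : inR i -> in_kernel x -> cusp c (s i * x) = a i * cusp c x.
Proof.
move=> Ri Kx; rewrite !(@cusp_base c i) //; last exact: in_kernelMl.
rewrite theta_kernel_genl // rmorphM mulrDr !mulrA.
by congr (_ * _ + _ * _); rewrite mulrDl mulrDr ?mulrA -!C_central ?mulrA.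
Qed.

Lemma cuspZ c b x : cusp c (b *: x) = C b * cusp c x.
Proof.
by rewrite /cusp (thetaZ inR1) quot_projZ mulrDr !mulrA !C_central.
Qed.

Lemma cuspD c x y : cusp c (x + y) = cusp c x + cusp c y.
Proof.
by rewrite /cusp (thetaD inR1) rmorphD (mulrDr (a 1 + _)) (mulrDr (_ * _ + _)) addrACA.
Qed.

Lemma cusp0 c : cusp c 0 = 0.
Proof. by rewrite -(scale0r 1) cuspZ rmorph0 mul0r. Qed.

Lemma cuspMl c y x : in_kernel x -> cusp c (y * x) = q y * cusp c x.
Proof.
move=> Kx; elim/(cubic_ind R_cubic): y => [b y IH|y y' IH IH'||i y Ri IH].
- by rewrite -scalerAl cuspZ IH quot_projZ mulrA.
- by rewrite mulrDl cuspD IH IH' rmorphD mulrDl.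
- by rewrite mul1r rmorph1 mul1r.
- by rewrite -mulrA cusp_genl ?IH ?rmorphM ?mulrA //; exact: in_kernelMl.
Qed.

Lemma cuspMr c x y : in_kernel x -> cusp c (x * y) = cusp c x * q y.
Proof.
by move=> Kx; rewrite /cusp theta_kernelM // rmorphM (mulrDl ((a 1 + _) * _)) !mulrA.
Qed.

Definition eigen_ideal (al : k) : set R := [set eigenproj al%:A (s 1)]%classic.

Section EigenIdeal.
Variables (al be ga : k).
Hypothesis roots : all_roots j al be ga.
Let P := eigenproj al%:A (s 1).
Let r1 := all_rootsR roots.
Let r2 := all_rootsR r1.

Lemma C_roots : all_roots (C j) (C al) (C be) (C ga).
Proof. exact: all_roots_morph. Qed.

Lemma R_roots : all_roots j%:A al%:A be%:A (ga%:A : R).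
Proof. exact: (all_roots_morph (in_alg R) roots). Qed.

Lemma R_char2 : (1 + 1 : R) = 0.
Proof. by rewrite -(rmorph1 (in_alg R)) -rmorphD char2 rmorph0. Qed.

Lemma R_ww : j%:A * j%:A = 1 + j%:A :> R.
Proof. by rewrite -scalerAl mul1r scalerA jj scalerDl scale1r. Qed.

Lemma R_wC (x : R) : j%:A * x = x * j%:A.
Proof. by rewrite mulr_algl mulr_algr. Qed.

Lemma k_wC (x : k) : j * x = x * j.
Proof. exact: mulrC. Qed.

Lemma in_kernelP x : character al x = 0 -> character be x = 0 ->
  character ga x = 0 -> in_kernel x.
Proof. by case: roots => xa xb xc. Qed.

Lemma character_P :
  [/\ character al P = 1, character be P = 0 & character ga P = 0].
Proof.
rewrite /P (character_eigenproj roots _ inR1) (character_eigenproj r1 _ inR1)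
  (character_eigenproj r2 _ inR1) /eigenproj.
by split; case: roots;
  f4_ring j (Nil k) (Nil (seq nat * seq nat)) char2 jj k_wC ltac:(idtac).
Qed.

Lemma character_P1 : character al P = 1.
Proof. by have [] := character_P. Qed.

(** The other two characters already vanish on the ideal, and P has values 1, 0, 0 at al, be, ga. *)
Lemma eigen_ideal_kernel x : ideal_gen (eigen_ideal al) x ->
  in_kernel (x + character al x *: P).
Proof.
have [Pal Pbe Pga] := character_P => Ix.
have xbe : character be x = 0.
  by apply: (character_ideal r1 Ix) => y ->.
have xga : character ga x = 0.
  by apply: (character_ideal r2 Ix) => y ->.
apply: in_kernelP.
- by rewrite (characterD roots) (characterZ roots) Pal mulr1 (addrr2 char2).
- by rewrite (characterD r1) (characterZ r1) xbe Pbe mulr0 addr0.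
- by rewrite (characterD r2) (characterZ r2) xga Pga mulr0 addr0.
Qed.

Lemma eigenproj_mem : ideal_gen (eigen_ideal al) P.
Proof. exact: IdealMem. Qed.

Lemma kernel_mul_eigenproj y : in_kernel (y * P + character al y *: P).
Proof.
have := eigen_ideal_kernel (IdealMl y eigenproj_mem).
by rewrite (characterM roots) character_P1 mulr1.
Qed.

Lemma kernel_eigenproj_mul y : in_kernel (P * y + character al y *: P).
Proof.
have := eigen_ideal_kernel (IdealMr y eigenproj_mem).
by rewrite (characterM roots) character_P1 mul1r.
Qed.

Let d i := P + eigenproj al%:A (s i).

Lemma eigenproj_diffE i : d i = (al * al) *: (s i + s 1) + al *: (s i * s i + s 1 * s 1).
Proof.
rewrite /d addrC (eigenproj_add R_char2 R_ww R_wC _ _ R_roots).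
by rewrite -scalerAl mul1r scalerA !mulr_algl.
Qed.

Lemma kernel_eigenproj_diff i : inR i -> in_kernel (d i).
Proof.
move=> Ri.
have e c be' ga' (r : all_roots j c be' ga') : character c (d i) = 0.
  rewrite (characterD r) (character_eigenproj r _ inR1) (character_eigenproj r _ Ri).
  exact: (addrr2 char2).
by apply: in_kernelP; [exact: e roots | exact: e r1 | exact: e r2].
Qed.

Lemma cusp_eigenproj_diff i : inR i -> cusp al (d i) = 0.
Proof.
move=> Ri; rewrite eigenproj_diffE /cusp (thetaD inR1) !(thetaZ inR1) !(thetaD inR1).
rewrite (theta_genl inR1 _ Ri) (theta_genl inR1 _ inR1) !(theta_gen inR1) // ?inR1 //.
rewrite (addrr2 A_char2) mul0r mulr0 !addr0.
rewrite rmorphD !quot_projZ !(rmorphD q) !rmorphM.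
exact: (eigenproj_diff A_char2 A_ww (C_central j) C_roots (a_cube inR1) (a_cube Ri)).
Qed.

(** As s_i + al kills p_al(s_i), P may be replaced by the difference [d i], which is in the common
    kernel and has zero cusp. *)
Lemma gen_eigenproj i : inR i -> s i * P + al *: P = (s i + al%:A) * d i.
Proof.
move=> Ri; rewrite -(mulr_algl al P).
exact: (eigenproj_shiftl R_char2 R_ww R_wC _ R_roots (cubic_cube R_cubic Ri)).
Qed.

Lemma eigenproj_gen i : inR i -> P * s i + al *: P = d i * (s i + al%:A).
Proof.
move=> Ri; rewrite -(mulr_algl al P).
exact: (eigenproj_shiftr R_char2 R_ww R_wC _ R_roots (cubic_cube R_cubic Ri)).
Qed.

Lemma cusp_mul_eigenproj y : cusp al (y * P + character al y *: P) = 0.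
Proof.
elim/(cubic_ind R_cubic): y => [b y IH|y y' IH IH'||i y Ri IH].
- by rewrite (characterZ roots) -scalerAl -scalerA -scalerDr cuspZ IH mulr0.
- by rewrite (characterD roots) mulrDl scalerDl addrACA cuspD IH IH' addr0.
- by rewrite (character1 roots) mul1r scale1r (addrr2 R_char2) cusp0.
- have -> : s i * y * P + character al (s i * y) *: P =
      s i * (y * P + character al y *: P) +
      character al y *: (s i * P + al *: P).
    rewrite (character_genl roots y Ri) (mulrDr (s i) (y * P)).
    rewrite (scalerDr (character al y) (s i * P)) -(scalerAr _ (s i) P) mulrA scalerA.
    by rewrite mulrC -!addrA [X in _ = _ + X]addrA (addrr2 R_char2) add0r.
  rewrite cuspD cuspMl ?IH ?mulr0 ?add0r; last exact: kernel_mul_eigenproj.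
  by rewrite cuspZ gen_eigenproj // cuspMl ?cusp_eigenproj_diff ?mulr0 //;
    exact: kernel_eigenproj_diff.
Qed.

Lemma cusp_eigenproj_mul y : cusp al (P * y + character al y *: P) = 0.
Proof.
elim/(cubic_indr R_cubic): y => [b y IH|y y' IH IH'||i y Ri IH].
- by rewrite (characterZ roots) -scalerAr -scalerA -scalerDr cuspZ IH mulr0.
- by rewrite (characterD roots) mulrDr scalerDl addrACA cuspD IH IH' addr0.
- by rewrite (character1 roots) mulr1 scale1r (addrr2 R_char2) cusp0.
- have -> : P * (y * s i) + character al (y * s i) *: P =
      (P * y + character al y *: P) * s i +
      character al y *: (P * s i + al *: P).
    rewrite (characterM roots) (character_gen roots Ri) (mulrDl (P * y)).
    rewrite (scalerDr (character al y) (P * s i)) -(scalerAl _ P (s i)).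
    by rewrite mulrA scalerA -!addrA [X in _ = _ + X]addrA (addrr2 R_char2) add0r.
  rewrite cuspD cuspMr ?IH ?mul0r ?add0r; last exact: kernel_eigenproj_mul.
  by rewrite cuspZ eigenproj_gen // cuspMr ?cusp_eigenproj_diff ?mul0r ?mulr0 //;
    exact: kernel_eigenproj_diff.
Qed.

(** The correction by P is needed because [cusp] is compatible with products only on the common
    kernel; each product splits into a multiple of a corrected element and a corrected multiple of
    P. *)
Lemma cusp_ideal x : ideal_gen (eigen_ideal al) x ->
  cusp al (x + character al x *: P) = 0.
Proof.
elim=> {x} [x ->||x y Ix IHx Iy IHy|y x Ix IHx|y x Ix IHx].
- by rewrite -/P character_P1 scale1r (addrr2 R_char2) cusp0.
- by rewrite (character0 roots) scale0r addr0 cusp0.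
- by rewrite (characterD roots) scalerDl addrACA cuspD IHx IHy addr0.
- have -> : y * x + character al (y * x) *: P =
      y * (x + character al x *: P) +
      character al x *: (y * P + character al y *: P).
    rewrite (characterM roots) (mulrDr y x) (scalerDr (character al x) (y * P)).
    rewrite -(scalerAr _ y P) scalerA.
    by rewrite mulrC -!addrA [X in _ = _ + X]addrA (addrr2 R_char2) add0r.
  rewrite cuspD cuspMl ?IHx ?mulr0 ?add0r; last exact: eigen_ideal_kernel.
  by rewrite cuspZ cusp_mul_eigenproj mulr0.
- have -> : x * y + character al (x * y) *: P =
      (x + character al x *: P) * y +
      character al x *: (P * y + character al y *: P).
    rewrite (characterM roots) (mulrDl x) (scalerDr (character al x) (P * y)).
    rewrite -(scalerAl _ P y) scalerA.
    by rewrite -!addrA [X in _ = _ + X]addrA (addrr2 R_char2) add0r.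
  rewrite cuspD cuspMr ?IHx ?mul0r ?add0r; last exact: eigen_ideal_kernel.
  by rewrite cuspZ cusp_eigenproj_mul mulr0.
Qed.

End EigenIdeal.

Lemma eigen_ideal_cap x :
  ideal_gen (eigen_ideal 1) x -> ideal_gen (eigen_ideal j) x ->
  ideal_gen (eigen_ideal (1 + j)) x -> ideal_gen X x.
Proof.
have [[r0 r1] r2] := (AllRoots012 j, AllRoots120 j, AllRoots201 j).
move=> I0 I1 I2; apply/quot_proj_eq0.
have x0 : character 1 x = 0.
  by apply: (character_ideal r0 I1) => y ->; have [] := character_P r1.
have x1 : character j x = 0.
  by apply: (character_ideal r1 I0) => y ->; have [] := character_P r0.
have x2 : character (1 + j) x = 0.
  by apply: (character_ideal r2 I0) => y ->; have [] := character_P r0.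
have := cusp_ideal r0 I0; have := cusp_ideal r1 I1; have := cusp_ideal r2 I2.
rewrite x0 x1 x2 !scale0r !addr0 /cusp rmorphD rmorph1 => e2 e1 e0.
(* Weight each equation by its own root c: the sums of c and c^2 are 0, the sum of c^3 is 1. *)
transitivity (((a 1 + 1) * theta 1 x + (a 1 * a 1 + 1 * 1) * q x) +
  C j * ((a 1 + C j) * theta 1 x + (a 1 * a 1 + C j * C j) * q x) +
  (1 + C j) * ((a 1 + (1 + C j)) * theta 1 x +
               (a 1 * a 1 + (1 + C j) * (1 + C j)) * q x)).
  rewrite -[LHS]/(q x); move: (theta 1 x) (q x) (a 1) => t y b.
  by f4_ring (C j) [:: t; y; b] (Nil (seq nat * seq nat)) A_char2 A_ww (C_central j) ltac:(idtac).
by rewrite e0 e1 e2 !mulr0 !addr0.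
Qed.

(** * Chinese remainders and the dimension of the image *)

Lemma eigen_ideal_gen al be ga i : all_roots j al be ga -> inR i ->
  ideal_gen (eigen_ideal al) (eigenproj al%:A (s i)).
Proof.
move=> r; case: i => // i; elim: i => [|i IHi] Ri; first exact: IdealMem.
have Ri0 : inR i.+1 by rewrite /inR /= ltnW // (andP Ri).2.
have [i3 i3'] := (cubic_cube R_cubic Ri0, cubic_cube R_cubic Ri).
have conj : s i.+1 * s i.+2 * s i.+1 = s i.+2 * (s i.+1 * s i.+2).
  by rewrite (cubic_braid R_cubic Ri0 Ri) !mulrA.
have inv : s i.+1 * s i.+2 * (s i.+2 * s i.+2 * (s i.+1 * s i.+1)) = 1.
  by rewrite !mulrA -(mulrA (s i.+1)) -(mulrA (s i.+1)) i3' mulr1 i3.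
have e : eigenproj al%:A (s i.+2) * (s i.+1 * s i.+2) =
    s i.+1 * s i.+2 * eigenproj al%:A (s i.+1).
  exact: (eigenproj_conj R_char2 R_ww R_wC (R_roots r) conj).
have -> : eigenproj al%:A (s i.+2) = s i.+1 * s i.+2 *
    eigenproj al%:A (s i.+1) * (s i.+2 * s i.+2 * (s i.+1 * s i.+1)).
  by rewrite -e -(mulrA (eigenproj _ _)) inv mulr1.
exact/IdealMr/IdealMl/IHi.
Qed.

Lemma k_addr (x : k) : x + x = 0.
Proof. exact: addrr2. Qed.

Lemma R_addr (x : R) : x + x = 0.
Proof. exact: (addrr2 R_char2). Qed.

(** The kernel is generated by the s_i + al, and s_i + al = (s_i + al)(p_be(s_i) + p_ga(s_i)). *)
Lemma kernel_character al be ga x : all_roots j al be ga -> character al x = 0 ->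
  exists y z, [/\ ideal_gen (eigen_ideal be) y, ideal_gen (eigen_ideal ga) z & x = y + z].
Proof.
move=> r; pose S u := exists y z,
  [/\ ideal_gen (eigen_ideal be) y, ideal_gen (eigen_ideal ga) z & u = y + z].
have SD u u' : S u -> S u' -> S (u + u').
  move=> [y [z [Iy Iz ->]]] [y' [z' [Iy' Iz' ->]]]; exists (y + y'), (z + z').
  by split; [exact: IdealD | exact: IdealD | rewrite addrACA].
have SM b u : S u -> S (b * u).
  move=> [y [z [Iy Iz ->]]]; exists (b * y), (b * z).
  by split; [exact: IdealMl | exact: IdealMl | rewrite mulrDr].
have SZ c u : S u -> S (c *: u) by rewrite -mulr_algl; exact: SM.
have r1 := all_rootsR r; have r2 := all_rootsR r1.
have Sgen i : inR i -> S (s i + al%:A).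
  move=> Ri; exists ((s i + al%:A) * eigenproj be%:A (s i)),
    ((s i + al%:A) * eigenproj ga%:A (s i)).
  split; [exact/IdealMl/(eigen_ideal_gen r1 Ri) | exact/IdealMl/(eigen_ideal_gen r2 Ri)|].
  rewrite {1}(eigenproj_decr R_char2 R_ww R_wC (s i) (s i + al%:A) (R_roots r)).
  rewrite -[LHS]addrA [X in X + _](_ : _ = 0) ?add0r // (mulrDl (s i)).
  have -> : s i * eigenproj al%:A (s i) = al%:A * eigenproj al%:A (s i).
    exact: (eigenprojM R_char2 R_ww R_wC (R_roots r) (cubic_cube R_cubic Ri)).
  exact: R_addr.
have Sx u : S (u + (character al u)%:A).
  elim/(cubic_ind R_cubic): u => [c u Su|u u' Su Su'||i u Ri Su].
  - by rewrite (characterZ r) -scalerA -scalerDr; exact: SZ.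
  - by rewrite (characterD r) scalerDl addrACA; exact: SD.
  - rewrite (character1 r) scale1r R_addr.
    by exists 0, 0; split; [exact: Ideal0 | exact: Ideal0 | rewrite addr0].
  - rewrite (character_genl r) //.
    have -> : s i * u + (al * character al u)%:A =
        s i * (u + (character al u)%:A) + character al u *: (s i + al%:A).
      rewrite mulrDr scalerDr mulr_algr -addrA; congr (_ + _).
      by rewrite addrA R_addr add0r scalerA mulrC.
    by apply: SD; [exact: SM | exact/SZ/Sgen].
by move=> x0; have := Sx x; rewrite x0 scale0r addr0.
Qed.

(** Expand x = x p_al + x p_be + x p_ga, and split the first x along I_be + I_ga and the second
    along I_ga + I_al. The terms outside I_ga form z: each is a product of an element of I_al and an
    element of I_be. *)
Lemma ideal_correction al be ga x : all_roots j al be ga ->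
  character al x = 0 -> character be x = 0 -> exists z,
    [/\ ideal_gen (eigen_ideal al) z, ideal_gen (eigen_ideal be) z &
        ideal_gen (eigen_ideal ga) (x + z)].
Proof.
move=> r xal xbe; have r1 := all_rootsR r; have r2 := all_rootsR r1.
pose P c := eigenproj c%:A (s 1).
have [ub [uc [Iub Iuc def_u]]] := kernel_character r xal.
have [vc [va [Ivc Iva def_v]]] := kernel_character r1 xbe.
exists (ub * P al + va * P be); split.
- apply: IdealD; [exact/IdealMl/(eigen_ideal_gen r inR1) | exact: IdealMr].
- apply: IdealD; [exact: IdealMr | exact/IdealMl/(eigen_ideal_gen r1 inR1)].
have -> : x + (ub * P al + va * P be) = x * P ga + (uc * P al + vc * P be).
  rewrite {1}(eigenproj_decr R_char2 R_ww R_wC (s 1) x (R_roots r)) -/(P al) -/(P be) -/(P ga).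
  rewrite [X in X + _]addrC -[LHS]addrA; congr (_ + _).
  rewrite {1}def_u def_v (mulrDl ub) (mulrDl vc) [LHS]addrACA; congr (_ + _).
    by rewrite addrAC R_addr add0r.
  by rewrite -addrA R_addr addr0.
apply: IdealD; first exact/IdealMl/(eigen_ideal_gen r2 inR1).
by apply: IdealD; exact: IdealMr.
Qed.

Lemma character_eigenproj1 al be ga : all_roots j al be ga ->
  [/\ character al (eigenproj al%:A (s 1)) = 1,
      character al (eigenproj be%:A (s 1)) = 0 &
      character al (eigenproj ga%:A (s 1)) = 0].
Proof.
move=> r; have r1 := all_rootsR r; have r2 := all_rootsR r1.
by have [[[? _ _] [_ _ ?]] [_ ? _]] := (character_P r, character_P r1, character_P r2).
Qed.

Lemma eigenprojE c (x : R) :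
  eigenproj c%:A x = 1 + (c * c) *: x + c *: (x * x).
Proof. by rewrite /eigenproj -!mulrA !mulr_algl scalerA. Qed.

Section HeckeQuotient.
Variables (al be ga : k).
Hypothesis roots : all_roots j al be ga.
Let I := eigen_ideal al.
Let qI : {rmorphism R -> quot_alg I} := @quot_proj k R I.

(** Multiplied by al^2, p_al(s_i) = 0 reads s_i^2 = al s_i + al^2. *)
Lemma quot_hecke_operators : @hecke_operators k al (al * al) n (quot_alg I)
  (fun i x => qI (s i) * x).
Proof.
split.
- move=> i c x y; rewrite mulrDr; congr (_ + _).
  by rewrite quot_scalerAr.
- move=> i x Ri; have [y <-] := quot_proj_surj x.
  rewrite -[quot_proj _ y]/(qI y) -!rmorphM -!linearZ -rmorphD.
  apply/quot_projP; rewrite (_ : _ - _ = (al * al) *: (eigenproj al%:A (s i) * y)).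
    rewrite -[(al * al) *: _]mulr_algl.
    exact/IdealMl/IdealMr/(eigen_ideal_gen roots).
  have oppR (z : R) : - z = z by apply: (addrI z); rewrite subrr R_addr.
  have al3 := all_roots_cube roots.
  rewrite oppR eigenprojE !mulrDl mul1r !scalerDr -!scalerAl !scalerA.
  have al4 : al * al * (al * al) = al by rewrite mulrA al3 mul1r.
  by rewrite al4 al3 scale1r mulrA addrC; congr (_ + _); rewrite addrC.
- move=> i h x Ri Rh ih; have [y <-] := quot_proj_surj x.
  by rewrite -[quot_proj _ y]/(qI y) -!rmorphM !mulrA (cubic_far R_cubic).
- move=> i x Ri Ri1; have [y <-] := quot_proj_surj x.
  by rewrite -[quot_proj _ y]/(qI y) -!rmorphM !mulrA (cubic_braid R_cubic).
Qed.

(** The map is x |-> x v into the regular module. If x v = 0, the universal map from V to the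
    quotient, which sends v to 1, shows that x is 0 in the quotient. *)
Lemma hecke_quotient : exists (V : vectType k) (pi : R -> V),
  [/\ \dim {:V} = n`!, linear pi, forall u, exists x, pi x = u &
      forall x, pi x = 0 <-> ideal_gen I x].
Proof.
have [V [T [v [dimV V_regular]]]] := exists_hecke_regular al (al * al) n.
have TP := regular_operators V_regular.
have al3 := all_roots_cube roots.
have V_addr (u : V) : u + u = 0.
  by rewrite -[u]scale1r -scalerDl char2 scale0r.
have T_cube i u : inR i -> T i (T i (T i u)) = u.
  move=> Ri; rewrite (hecke_quad TP) // (hecke_quad TP) // scalerDr !scalerA.
  by rewrite addrAC V_addr add0r mulrA al3 scale1r.
have [||||rho [rho_lin rho1 rhoM]] := cubic_module R_cubic (T := T).
- exact: hecke_lin TP.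
- exact: T_cube.
- exact: hecke_far TP.
- exact: hecke_braid TP.
have rho_lin' x : linear (rho x).
  elim/(cubic_ind R_cubic): x => [c x IH|x y IHx IHy||i x Ri IH] b u u'.
  - rewrite !(unbundled_linearZ (rho_lin _)) IH scalerDr !scalerA.
    by rewrite (mulrC b).
  - by rewrite !(unbundled_linearD (rho_lin _)) IHx IHy scalerDr addrACA.
  - by rewrite !rho1.
  - by rewrite !rhoM // IH (hecke_lin TP).
have rhoMM x y u : rho (x * y) u = rho x (rho y u).
  elim/(cubic_ind R_cubic): x => [c x IH|x x' IH IH'||i x Ri IH].
  - by rewrite -scalerAl !(unbundled_linearZ (rho_lin _)) IH.
  - by rewrite mulrDl !(unbundled_linearD (rho_lin _)) IH IH'.
  - by rewrite mul1r rho1.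
  - by rewrite -mulrA !rhoM // IH.
exists V, (rho^~ v); split=> //.
- move=> u; elim/(regular_cyclic V_regular): u => [c _ [x <-]|_ _ [x <-] [y <-]||i _ Ri [x <-]].
  + by exists (c *: x); rewrite (unbundled_linearZ (rho_lin _)).
  + by exists (x + y); rewrite (unbundled_linearD (rho_lin _)).
  + by exists 1.
  + by exists (s i * x); rewrite rhoM.
- move=> x; split=> [x0|Ix].
    have [psi [psi_lin psi_v psiT]] :=
      regular_universal V_regular (1 : quot_alg I) quot_hecke_operators.
    have psi_rho y : psi (rho y v) = qI y.
      elim/(cubic_ind R_cubic): y => [c y IH|y y' IH IH'||i y Ri IH].
      + by rewrite (unbundled_linearZ (rho_lin _)) (unbundled_linearZ psi_lin) IH /= linearZ.
      + by rewrite (unbundled_linearD (rho_lin _)) (unbundled_linearD psi_lin) IH IH' rmorphD.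
      + by rewrite rho1 psi_v rmorph1.
      + by rewrite rhoM // psiT // IH rmorphM.
    apply/quot_proj_eq0; rewrite -[quot_proj _ x]/(qI x) -psi_rho x0.
    exact: unbundled_linear0 psi_lin.
  have rho0 y : rho y 0 = 0 := unbundled_linear0 (rho_lin' y).
  (* Vanishing on all of V is needed for stability under right multiplication. *)
  suff: forall u, rho x u = 0 by apply.
  elim: Ix => {x} [x ->||x y _ IHx _ IHy|y x _ IHx|y x _ IHx] u.
  + rewrite eigenprojE 2!(unbundled_linearD (rho_lin _)) rho1.
    rewrite !(unbundled_linearZ (rho_lin _)).
    have rho_s : rho (s 1) u = T 1%N u by rewrite -[s 1]mulr1 (rhoM _ _ _ inR1) rho1.
    rewrite (rhoM _ _ _ inR1) rho_s (hecke_quad TP _ inR1) scalerDr !scalerA.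
    by rewrite addrA -[X in X + _]addrA V_addr addr0 mulrA al3 scale1r V_addr.
  + exact: unbundled_linear0 (rho_lin u).
  + by rewrite (unbundled_linearD (rho_lin _)) IHx IHy addr0.
  + by rewrite rhoMM IHx.
  + by rewrite rhoMM IHx.
Qed.

End HeckeQuotient.

Lemma linear_factor (U V W : lmodType k) (f : U -> V) (g : U -> W) :
  linear f -> linear g -> (forall v, exists x, f x = v) ->
  (forall x, f x = 0 -> g x = 0) ->
  exists h : {linear V -> W}, forall x, h (f x) = g x.
Proof.
move=> fl gl f_surj fg; pose h v := g (sval (cid (f_surj v))).
have hf x : h (f x) = g x.
  rewrite /h; case: cid => y /= fy; apply/eqP; rewrite -subr_eq0; apply/eqP.
  have gB : g (-1 *: x + y) = - g x + g y by rewrite gl scaleN1r.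
  by rewrite addrC -gB; apply: fg; rewrite fl fy scaleN1r addNr.
have h_lin : linear h.
  move=> c u v; have [x <-] := f_surj u; have [y <-] := f_surj v.
  by rewrite -fl !hf gl.
pose hL := GRing.isLinear.Build k V W _ h h_lin.
pose h' : {linear V -> W} := HB.pack h hL.
by exists h'.
Qed.

Lemma eigen_ideal_crt x0 x1 x2 :
  character 1 x1 = character 1 x2 -> character j x0 = character j x2 ->
  character (1 + j) x0 = character (1 + j) x1 -> exists x,
  [/\ ideal_gen (eigen_ideal 1) (x + x0), ideal_gen (eigen_ideal j) (x + x1) &
      ideal_gen (eigen_ideal (1 + j)) (x + x2)].
Proof.
move=> e0 e1 e2; have [[r0 r1] r2] := (AllRoots012 j, AllRoots120 j, AllRoots201 j).
pose P c := eigenproj c%:A (s 1).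
(* y only has the prescribed characters; each of the three corrections then adjusts one component
   and lies in the ideals of the other two. *)
pose y := character 1 x1 *: P 1 + character j x0 *: P j + character (1 + j) x0 *: P (1 + j).
have [y0 y1 y2] : [/\ character 1 y = character 1 x1, character j y = character j x0 &
    character (1 + j) y = character (1 + j) x0].
  have [a0 a1 a2] := character_eigenproj1 r0.
  have [b0 b1 b2] := character_eigenproj1 r1.
  have [c0 c1 c2] := character_eigenproj1 r2.
  split.
  - by rewrite !(characterD r0) !(characterZ r0) a0 a1 a2 mulr1 !mulr0 !addr0.
  - by rewrite !(characterD r1) !(characterZ r1) b0 b1 b2 mulr1 !mulr0 addr0 add0r.
  - by rewrite !(characterD r2) !(characterZ r2) c0 c1 c2 mulr1 !mulr0 !add0r.
have [z0 [z01 z02 z00]] : exists z, [/\ ideal_gen (eigen_ideal j) z,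
    ideal_gen (eigen_ideal (1 + j)) z & ideal_gen (eigen_ideal 1) (x0 + y + z)].
  apply: (ideal_correction r1).
    by rewrite (characterD r1) y1 k_addr.
  by rewrite (characterD r2) y2 k_addr.
have [z1 [z12 z10 z11]] : exists z, [/\ ideal_gen (eigen_ideal (1 + j)) z,
    ideal_gen (eigen_ideal 1) z & ideal_gen (eigen_ideal j) (x1 + y + z)].
  apply: (ideal_correction r2).
    by rewrite (characterD r2) y2 e2 k_addr.
  by rewrite (characterD r0) y0 k_addr.
have [z2 [z20 z21 z22]] : exists z, [/\ ideal_gen (eigen_ideal 1) z,
    ideal_gen (eigen_ideal j) z & ideal_gen (eigen_ideal (1 + j)) (x2 + y + z)].
  apply: (ideal_correction r0).
    by rewrite (characterD r0) y0 e0 k_addr.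
  by rewrite (characterD r1) y1 e1 k_addr.
exists (y + z0 + z1 + z2); split.
- have -> : y + z0 + z1 + z2 + x0 = x0 + y + z0 + z1 + z2 by rewrite addrC !addrA.
  by apply: IdealD => //; apply: IdealD.
- have -> : y + z0 + z1 + z2 + x1 = x1 + y + z1 + z0 + z2.
    by rewrite addrC !addrA (addrAC _ z0).
  by apply: IdealD => //; apply: IdealD.
- have -> : y + z0 + z1 + z2 + x2 = x2 + y + z2 + z0 + z1.
    by rewrite addrC !addrA (addrAC _ z1) (addrAC _ z0).
  by apply: IdealD => //; apply: IdealD.
Qed.

Lemma character_linear al be ga : all_roots j al be ga ->
  linear (character al : R -> k^o).
Proof. by move=> r c x y; rewrite (characterD r) (characterZ r). Qed.

(** The image in the product of the three quotients consists of the triples on which each character,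
    defined on two of the factors, takes the same value. These are three independent linear
    conditions. *)
Lemma eigen_ideal_image : exists (d : nat) (f : R -> 'rV[k]_d),
  [/\ linear f, forall u, exists x, f x = u,
      forall x, f x = 0 <-> [/\ ideal_gen (eigen_ideal 1) x,
        ideal_gen (eigen_ideal j) x & ideal_gen (eigen_ideal (1 + j)) x] &
      d = (3 * (n`! - 1))%N].
Proof.
have [[r0 r1] r2] := (AllRoots012 j, AllRoots120 j, AllRoots201 j).
have [V0 [p0 [dim0 lin0 surj0 ker0]]] := hecke_quotient r0.
have [V1 [p1 [dim1 lin1 surj1 ker1]]] := hecke_quotient r1.
have [V2 [p2 [dim2 lin2 surj2 ker2]]] := hecke_quotient r2.
have factor al be ga (V : vectType k) (p : R -> V) (r : all_roots j al be ga) c be' ga' :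
    (all_roots j c be' ga') -> (c = be) \/ (c = ga) ->
    linear p -> (forall u, exists x, p x = u) ->
    (forall x, p x = 0 <-> ideal_gen (eigen_ideal al) x) ->
    exists h : {linear V -> k^o}, forall x, h (p x) = character c x.
  move=> rc c_be p_lin p_surj p_ker.
  apply: (linear_factor p_lin (character_linear rc) p_surj) => x /p_ker Ix.
  apply: (character_ideal rc Ix) => y ->.
  by have [_ ? ?] := character_P r; case: c_be => ->.
have [h10 h10E] : exists h : {linear V0 -> k^o}, forall x, h (p0 x) = character j x.
  by apply: factor r0 _ _ _ r1 _ lin0 surj0 ker0; left.
have [h20 h20E] : exists h : {linear V0 -> k^o}, forall x, h (p0 x) = character (1 + j) x.
  by apply: factor r0 _ _ _ r2 _ lin0 surj0 ker0; right.
have [h21 h21E] : exists h : {linear V1 -> k^o}, forall x, h (p1 x) = character (1 + j) x.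
  by apply: factor r1 _ _ _ r2 _ lin1 surj1 ker1; left.
have [h01 h01E] : exists h : {linear V1 -> k^o}, forall x, h (p1 x) = character 1 x.
  by apply: factor r1 _ _ _ r0 _ lin1 surj1 ker1; right.
have [h02 h02E] : exists h : {linear V2 -> k^o}, forall x, h (p2 x) = character 1 x.
  by apply: factor r2 _ _ _ r0 _ lin2 surj2 ker2; left.
have [h12 h12E] : exists h : {linear V2 -> k^o}, forall x, h (p2 x) = character j x.
  by apply: factor r2 _ _ _ r1 _ lin2 surj2 ker2; right.
pose E : vectType k := (V0 * V1 * V2)%type.
pose F : vectType k := (k^o * k^o * k^o)%type.
pose D (v : E) : F := (h01 v.1.2 - h02 v.2, h10 v.1.1 - h12 v.2, h20 v.1.1 - h21 v.1.2).
have D_lin : linear D.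
  have lB (t y z u e : k^o) : e *: t + y - (e *: z + u) = e *: (t - z) + (y - u).
    by rewrite opprD addrACA scalerBr.
  have lC (V V' : vectType k) (h : {linear V -> k^o}) (h' : {linear V' -> k^o}) e t y z u :
      h (e *: t + y) - h' (e *: z + u) = e *: (h t - h' z) + (h y - h' u).
    by rewrite (linearP h) (linearP h') lB.
  by move=> c u v; rewrite /D /= !lC.
pose D' : {linear E -> F} := HB.pack D (GRing.isLinear.Build k E F _ D D_lin).
pose U := lker (linfun D').
pose p x : E := (p0 x, p1 x, p2 x).
have p_lin : linear p by move=> c x y; rewrite /p lin0 lin1 lin2.
have pU x : p x \in U.
  rewrite memv_ker lfunE /= /D /= h01E h02E h10E h12E h20E h21E.
  by apply/eqP; rewrite !subrr.
have p_surj u : u \in U -> exists x, p x = u.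
  rewrite memv_ker lfunE /= /D => /eqP.
  case: u => [[u0 u1] u2] /=.
  have [[x0 <-] [[x1 <-] [x2 <-]]] := (surj0 u0, (surj1 u1, surj2 u2)).
  rewrite h01E h02E h10E h12E h20E h21E.
  case=> /eqP; rewrite subr_eq0 => /eqP e0 /eqP; rewrite subr_eq0 => /eqP e1 /eqP.
  rewrite subr_eq0 => /eqP e2.
  have [x [I0 I1 I2]] := eigen_ideal_crt e0 e1 e2; exists x.
  have eqp (V : vectType k) (q' : R -> V) y : linear q' -> q' (x + y) = 0 -> q' x = q' y.
    move=> ql; rewrite (unbundled_linearD ql) => /eqP; rewrite addr_eq0 => /eqP ->.
    by rewrite -scaleN1r -[-1]addr0 -(k_addr 1) addrA addNr add0r scale1r.
  by congr (_, _, _); apply: eqp => //; [apply/ker0 | apply/ker1 | apply/ker2].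
have dimU : \dim U = (3 * (n`! - 1))%N.
  have [a0 a1 a2] := character_eigenproj1 r0.
  have [b0 b1 b2] := character_eigenproj1 r1.
  have [c0 c1 c2] := character_eigenproj1 r2.
  pose P c := eigenproj c%:A (s 1).
  have img : (linfun D' @: {:E} = {:F})%VS.
    apply/eqP; rewrite eqEsubv subvf; apply/subvP=> [[[t0 t1] t2]] _.
    (* Each P c has value 1 at the character c and 0 at the others, so u shows the conditions to be
       independent. *)
    pose u : E := (t1 *: p0 (P j) + t2 *: p0 (P (1 + j)), t0 *: p1 (P 1), 0).
    have -> : (t0, t1, t2) = linfun D' u.
      have Z1 c : c *: (1 : k^o) = c by exact: mulr1.
      rewrite lfunE /= /D /= [h02 0]linear0 [h12 0]linear0 !subr0.
      rewrite (linearD h10) (linearD h20) !(linearZ_LR h10) !(linearZ_LR h20).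
      rewrite (linearZ_LR h01) (linearZ_LR h21) h01E !h10E !h20E h21E a0 b0 b1 c0 c1 c2.
      by rewrite !scaler0 !Z1 addr0 add0r subr0.
    by rewrite memv_img ?memvf.
  have := limg_ker_dim (linfun D') {:E}; rewrite capfv img.
  have -> : \dim {:F} = 3%N by rewrite dimvf.
  have -> : \dim {:E} = (n`! + n`! + n`!)%N.
    by rewrite -{1}dim0 -{1}dim1 -dim2 !dimvf.
  by rewrite -/U => dimU; rewrite mulnBr muln1 -(addnK 3 (\dim U)) dimU !mulSn mul0n addn0 addnA.
exists (\dim U), (fun x => \row_i coord (vbasis U) i (p x)); split => //.
- by move=> c x y; apply/rowP=> i; rewrite !mxE p_lin linearP.
- move=> u; have [|x px] := p_surj (\sum_i u 0 i *: (vbasis U)`_i).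
    by apply: rpred_sum => i _; apply: rpredZ; rewrite vbasis_mem ?mem_nth ?size_tuple.
  exists x; apply/rowP=> i; rewrite mxE px coord_sum_free //.
  exact: basis_free (vbasisP U).
- move=> x; split.
    move=> px0; have : p x = 0.
      rewrite (coord_vbasis (pU x)) big1 // => i _.
      by have /rowP/(_ i) := px0; rewrite !mxE => ->; rewrite scale0r.
    by case=> *; split; [apply/ker0 | apply/ker1 | apply/ker2].
  case=> /ker0 x0 /ker1 x1 /ker2 x2; have px0 : p x = 0 by rewrite /p x0 x1 x2.
  by apply/rowP=> i; rewrite !mxE px0 linear0.
Qed.

Lemma quat_rel_eigen_ideal al be ga x : all_roots j al be ga ->
  ideal_gen X x -> ideal_gen (eigen_ideal al) x.
Proof.
have inR2 : inR 2 by rewrite /inR.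
move=> r; elim=> {x} [x ->||x y _ Ix _ Iy|y x _ Ix|y x _ Ix].
- rewrite (quat_rel_eigen R_char2 R_ww R_wC _ _ (R_roots r)).
  have [I1 I2] := (eigen_ideal_gen r inR1, eigen_ideal_gen r inR2).
  by apply/IdealMl; do 3?apply: IdealD; first [exact: IdealMl | exact: IdealMr].
- exact: Ideal0.
- exact: IdealD.
- exact: IdealMl.
- exact: IdealMr.
Qed.

Lemma quat_rel_idealP x : ideal_gen X x <->
  [/\ ideal_gen (eigen_ideal 1) x, ideal_gen (eigen_ideal j) x &
      ideal_gen (eigen_ideal (1 + j)) x].
Proof.
split=> [Ix|[I0 I1 I2]]; last exact: eigen_ideal_cap.
split; [exact: quat_rel_eigen_ideal (AllRoots012 j) Ix
  | exact: quat_rel_eigen_ideal (AllRoots120 j) Ix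
  | exact: quat_rel_eigen_ideal (AllRoots201 j) Ix].
Qed.

End Separation.

(** * A quotient algebra with known coordinates, as a finite-dimensional algebra *)

Section FiniteDimensionalQuotient.
Variables (k : fieldType) (R : algType k) (X : set R) (d : nat).
Variable f : R -> 'rV[k]_d.
Hypotheses (f_lin : linear f) (f_surj : forall u, exists x, f x = u).
Hypotheses (f_ker : forall x, f x = 0 <-> ideal_gen X x) (d_gt0 : (0 < d)%N).

(** A separate name, to carry the structures that rest on f and on d > 0, in particular 1 != 0. *)
Definition fd_quot : Type := quot_alg X.
HB.instance Definition _ := GRing.PzRing.on fd_quot.
HB.instance Definition _ := GRing.Lmodule.on fd_quot.

Fact fd_quot_oner_neq0 : (1 : fd_quot) != 0.
Proof.
apply/eqP=> /quot_proj_eq0/f_ker f1.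
have [x fx] := f_surj (const_mx 1).
have : f x = 0.
  by apply/f_ker; rewrite -[x]mulr1; apply/IdealMl/f_ker.
rewrite fx => /rowP/(_ (Ordinal d_gt0)); rewrite !mxE.
by apply/eqP; exact: oner_neq0.
Qed.

HB.instance Definition _ :=
  GRing.PzSemiRing_isNonZero.Build fd_quot fd_quot_oner_neq0.
HB.instance Definition _ :=
  GRing.Lmodule_isLalgebra.Build k fd_quot (@quot_scalerAl k R X).
HB.instance Definition _ :=
  GRing.Lalgebra_isAlgebra.Build k fd_quot (@quot_scalerAr k R X).

Fact fd_quot_vector_axiom : Vector.axiom d fd_quot.
Proof.
pose g (y : fd_quot) := f (repr y).
have gE x : g (quot_proj X x) = f x.
  apply/eqP; rewrite -subr_eq0 /g -scaleN1r addrC -f_lin scaleN1r addrC.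
  exact/eqP/f_ker/repr_quot_proj.
exists g.
  move=> c y z; have [x <-] := quot_proj_surj y; have [x' <-] := quot_proj_surj z.
  by rewrite -linearZ -rmorphD !gE f_lin.
pose h (u : 'rV[k]_d) : fd_quot := quot_proj X (sval (cid (f_surj u))).
exists h => [y|u]; last by rewrite gE; case: cid.
have [x <-] := quot_proj_surj y; rewrite gE /h; case: cid => z /= fz.
apply/quot_projP/f_ker; rewrite -scaleN1r addrC f_lin fz scaleN1r addNr //.
Qed.

HB.instance Definition _ := Lmodule_hasFinDim.Build k fd_quot fd_quot_vector_axiom.
HB.instance Definition _ := Algebra_isFalgebra.Build k fd_quot.

Lemma fd_quot_exists : exists (H : falgType k) (pi : {rmorphism R -> H})
    (lift : H -> quot_alg X),
  [/\ scalable pi, forall x, lift (pi x) = quot_proj X x, injective lift,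
      forall y, exists x, pi x = y & \dim {: H} = d].
Proof.
exists fd_quot, (@quot_proj k R X : {rmorphism R -> fd_quot}), id; split=> //.
- exact: quot_proj_scalable.
- exact: quot_proj_surj.
- by rewrite dimvf.
Qed.

End FiniteDimensionalQuotient.

Lemma rmorph_factor (R A S : pzRingType) (pi : {rmorphism R -> A})
    (f : {rmorphism R -> S}) :
  (forall y, exists x, pi x = y) -> (forall x, pi x = 0 -> f x = 0) ->
  exists g : {rmorphism A -> S}, forall x, g (pi x) = f x.
Proof.
move=> pi_surj pif; pose g y := f (sval (cid (pi_surj y))).
have gE x : g (pi x) = f x.
  apply/eqP; rewrite -subr_eq0 -rmorphB; apply/eqP/pif.
  by case: cid => y /= pi_y; rewrite rmorphB pi_y subrr.
have gB : zmod_morphism g.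
  move=> y z; have [x <-] := pi_surj y; have [x' <-] := pi_surj z.
  by rewrite -rmorphB !gE rmorphB.
have gM : monoid_morphism g.
  split; first by rewrite -(rmorph1 pi) gE rmorph1.
  move=> y z; have [x <-] := pi_surj y; have [x' <-] := pi_surj z.
  by rewrite -rmorphM !gE rmorphM.
pose g' : {rmorphism A -> S} := HB.pack g
  (GRing.isZmodMorphism.Build _ _ g gB) (GRing.isMonoidMorphism.Build _ _ g gM).
by exists g'.
Qed.

(** * The element q lies in the ideal of the main relation *)

Definition shear1 (x : 'Z_3 * 'Z_3) : 'Z_3 * 'Z_3 := (x.1 + x.2, x.2).
Definition shear2 (x : 'Z_3 * 'Z_3) : 'Z_3 * 'Z_3 := (x.1, x.2 - x.1).

Lemma shear1_inj : injective shear1.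
Proof.
apply: (can_inj (g := fun z => (z.1 - z.2, z.2))) => -[x y].
by rewrite /shear1 /= addrK.
Qed.

Lemma shear2_inj : injective shear2.
Proof.
apply: (can_inj (g := fun z => (z.1, z.2 + z.1))) => -[x y].
by rewrite /shear2 /= subrK.
Qed.

(* The isomorphism from Gamma_3 to SL_2(3), as permutations of F_3^2. *)
Definition shear (i : nat) : {perm 'Z_3 * 'Z_3} :=
  if i == 1%N then perm shear1_inj else perm shear2_inj.

Lemma shear_rel u v : @gamma_rel 3 u v ->
  word_eval (fun i => shear (val i)) u = word_eval (fun i => shear (val i)) v.
Proof.
have c3 (x : 'Z_3) : x + x + x = 0.
  by case: x => [[|[|[|//]]] ?]; apply/val_inj.
have R (i : gamma_index 3) : sval i = 1%N \/ sval i = 2%N.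
  by case: i => [[|[|[|i]]]] //= _; [left|right].
case=> {u v} [i j|i j|i]; rewrite !word_evalE /=.
- by case: (R i) => ->; case: (R j) => ->.
- case: (R i) => ->; case: (R j) => -> // _; apply/perm.permP=> -[x y].
  rewrite !permM !permE /shear1 /shear2 /=; congr pair.
    by ring.
  by ring.
- case: (R i) => ->; apply/perm.permP=> -[x y]; rewrite !permM !permE /shear1 /shear2 /=.
    by congr pair; rewrite -[RHS]addr0 -(c3 y); ring.
  by congr pair; rewrite -[RHS]subr0 -(c3 x); ring.
Qed.

(** The square acts on F_3^2 as -1, which moves (1, 0). *)
Lemma gamma3_quaternion_order : ((sgen 3 1 * sgen 3 2 * sgen 3 1) ^+ 2 != 1)%g.
Proof.
pose f : gamma 3 -> {perm 'Z_3 * 'Z_3} := pres_lift shear_rel.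
have fM x y : f (x * y)%g = (f x * f y)%g.
  exact: (pres_lift_monoid_morphism shear_rel).2.
have f1 : f 1%g = 1%g := (pres_lift_monoid_morphism shear_rel).1.
have f_gen i : (0 < i < 3)%N -> f (sgen 3 i) = shear i.
  move=> Ri; rewrite (sgen_val (Sub i Ri : gamma_index 3)); exact: pres_lift_gen.
apply/eqP=> /(congr1 f); rewrite f1 expgS expg1 !fM !f_gen // => /perm.permP/(_ (1, 0)).
by rewrite !permM !permE.
Qed.

(** As h^2 has no fixed point, every orbit has exactly four elements and contributes 0; one orbit at
    a time is removed from r. *)
Lemma sum_orbits4 (T : choiceType) (M : zmodType) (h : T -> T) (F : T -> M) (r : seq T) :
  (forall x, h (h (h (h x))) = x) -> (forall x, h (h x) != x) ->
  (forall x, F x + F (h x) + F (h (h x)) + F (h (h (h x))) = 0) ->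
  uniq r -> {in r, forall x, h x \in r} -> \sum_(x <- r) F x = 0.
Proof.
move=> h4 h2 F0; have [m] := ubnP (size r); elim: m r => // m IHm.
case=> [|x r] le_m uniq_r r_closed; first by rewrite big_nil.
move: {r}(x :: r) (mem_head x r) le_m uniq_r r_closed => r xr le_m uniq_r r_closed.
have h_inj y z : h y = h z -> y = z by move=> e; rewrite -[y]h4 e h4.
have h1 y : h y != y by apply/eqP=> e; have := h2 y; rewrite !e eqxx.
pose O := [:: x; h x; h (h x); h (h (h x))].
have h3 y : h (h (h y)) != y.
  by apply/eqP=> e; have := h1 y; rewrite -{1}e h4 eqxx.
have uniq_O : uniq O.
  have [h1' h2' h3'] : [/\ forall y, y != h y, forall y, y != h (h y)
      & forall y, y != h (h (h y))] by split=> y; rewrite eq_sym.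
  by rewrite /= !inE !negb_or !h1' !h2' h3'.
have O_closed y : (h y \in O) = (y \in O).
  apply/idP/idP; rewrite !inE.
    by case/or4P=> /eqP; [rewrite -{1}[x]h4 | | |] => /h_inj ->; rewrite eqxx ?orbT.
  by case/or4P=> /eqP ->; rewrite ?h4 eqxx ?orbT.
have O_r y : y \in O -> y \in r.
  have cl z : z \in r -> h z \in r := r_closed z.
  by rewrite !inE => /or4P[] /eqP ->; rewrite ?cl ?xr.
pose r' := [seq y <- r | y \notin O].
have perm_r : perm_eq r (O ++ r').
  apply: uniq_perm => // [|y].
    rewrite cat_uniq uniq_O filter_uniq // andbT; apply/hasPn=> y.
    by rewrite mem_filter => /andP[].
  rewrite mem_cat mem_filter; case yO: (y \in O) => //=; exact: O_r.
rewrite (perm_big _ perm_r) big_cat /= !big_cons big_nil addr0 !addrA F0 add0r.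
apply: IHm; last 2 first.
- exact: filter_uniq.
- move=> y; rewrite !mem_filter O_closed => /andP[-> /r_closed] //.
- rewrite -ltnS; apply: leq_trans le_m; rewrite ltnS (perm_size perm_r) size_cat /=.
  by rewrite -[X in (X < _)%N]add0n ltn_add2r.
Qed.

Lemma galg_of_inj (k : comNzRingType) (G : groupType) : injective (@galg_of k G).
Proof.
move=> g h /(congr1 (fun x : group_algebra k G => mcoeff h x)).
by rewrite !mcoeffU eqxx; case: eqP => // _ /eqP; rewrite eq_sym oner_eq0.
Qed.

Lemma geometric_sum4 (B : pzRingType) (v x y : B) : y = 1 + v + v * v + v * v * v ->
  x + v * x + v * (v * x) + v * (v * (v * x)) = y * x.
Proof. by move=> ->; rewrite !mulrDl mul1r !mulrA. Qed.

Lemma q_elt_mem (k : fieldType) (j : k) (n : nat) (le3n : (3 <= n)%N) :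
  (1 + 1 : k) = 0 -> j * j = 1 + j ->
  ideal_gen [set quat_rel (galg_of k (sgen n 1)) (galg_of k (sgen n 2))]%classic
    (q_elt k le3n).
Proof.
move=> char2 jj.
pose u : gamma 3 := (sgen 3 1 * sgen 3 2 * sgen 3 1)%g.
have quaternion m : (2 < m)%N ->
    let a := galg_of k (sgen m 1) in let b := galg_of k (sgen m 2) in
    let v := a * b * a in (v * v * v * v = 1) *
    (quat_rel a b * (b * b * a) = 1 + v + v * v + v * v * v).
  move=> m_gt2 a b v; have [a3 _ braid _ _ _] := gamma_cubic_algebra k m.
  have R1 : (0 < 1 < m)%N by rewrite /= ltnW.
  have R2 : (0 < 2 < m)%N by [].
  exact: (braid_quaternion (R_char2 _ char2) (R_ww _ jj) (R_wC j (R := _))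
    (a3 _ R1) (a3 _ R2) (braid _ R1 R2)).
have u4 : (u * (u * (u * u)) = 1)%g.
  apply: (@galg_of_inj k); rewrite 3!(galg_ofM _ u) 2!galg_ofM galg_of1.
  have mul4 (B : pzRingType) (x : B) : x * x * x * x = 1 -> x * (x * (x * x)) = 1.
    by rewrite !mulrA.
  exact/mul4/(quaternion 3 isT).1.
have u2 : (u * u != 1)%g by have := gamma3_quaternion_order; rewrite expgS expg1.
have uQ g : Q g -> Q (u * g)%g.
  have d i : (0 < i < 3)%N -> gamma_C3 (sgen 3 i) = Zp1.
    move=> Ri; rewrite (sgen_val (Sub i Ri : gamma_index 3)).
    exact: (pres_lift_gen (@gamma_C3_subproof 3)).
  have dM x y : gamma_C3 (x * y)%g = (@gamma_C3 3 x * @gamma_C3 3 y)%g by exact: gmulfM.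
  by rewrite /Q /= dM => ->; rewrite mulg1 2!dM !d //; apply/val_inj.
apply/quot_proj_eq0; rewrite /q_elt.
(* A sum of infinite support is 0 by convention and is covered by the empty list. Otherwise r is the
   support, which is all of Q because basis elements are nonzero, and it is stable under u, of
   degree 3 and so in Q. *)
have [r [uniq_r r_closed ->]] : exists r : seq (gamma 3),
    [/\ uniq r, {in r, forall g, (u * g)%g \in r} &
      \sum_(g \in Q) galg_of k (gamma_map le3n g) =
      \sum_(g <- r) galg_of k (gamma_map le3n g)].
  have nz g : galg_of k g <> 0 :> group_algebra k (gamma n).
    by apply/eqP; rewrite monalgU_eq0 oner_eq0.
  case: finite_supportP => [_|r rQ Qr _]; first by exists nil; split.
  exists r; split=> [|g gr|//]; first exact: fset_uniq.
  apply/negPn/negP => ugr.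
  exact: (nz (gamma_map le3n (u * g)%g) (Qr _ (uQ _ (rQ _ gr)) ugr)).
rewrite rmorph_sum.
pose a := galg_of k (sgen n 1); pose b := galg_of k (sgen n 2).
have gM g : galg_of k (gamma_map le3n (u * g)%g) = a * b * a * galg_of k (gamma_map le3n g).
  have gmM x y : gamma_map le3n (x * y)%g = (gamma_map le3n x * gamma_map le3n y)%g.
    exact: gmulfM.
  rewrite gmM galg_ofM; congr (_ * _); rewrite 2!gmM.
  by rewrite !gamma_map_sgen // 2!galg_ofM.
apply: (@sum_orbits4 _ _ (fun g => u * g)%g) => //.
- by move=> g; rewrite -[RHS]mul1g -u4 !mulgA.
- by move=> g; rewrite mulgA -[X in _ != X]mul1g (inj_eq (mulIg g)).
- move=> g; rewrite -!rmorphD; apply/quot_proj_eq0.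
  rewrite !gM (geometric_sum4 _ (quaternion n le3n).2).
  by apply/IdealMr/IdealMr/IdealMem.
Qed.

Local Open Scope classical_set_scope.

(** * Translation of the relations and assembly of the two morphisms *)

Lemma ideal_gen_scale (k : comNzRingType) (R : algType k) (c : k) (y z x : R) :
  y = c *: z -> ideal_gen [set y] x -> ideal_gen [set z] x.
Proof.
move=> yz; elim=> {x} [_ ->||x x' _ Ix _ Ix'|a x _ Ix|a x _ Ix].
- by rewrite yz -mulr_algl; apply/IdealMl/IdealMem.
- exact: Ideal0.
- exact: IdealD.
- exact: IdealMl.
- exact: IdealMr.
Qed.

Lemma ideal_gen_sub (R : pzRingType) (X Y : set R) (x : R) :
  (forall y, Y y -> ideal_gen X y) -> ideal_gen Y x -> ideal_gen X x.
Proof.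
move=> YX; elim=> {x} [x /YX//||x y _ Ix _ Iy|y x _ Ix|y x _ Ix].
- exact: Ideal0.
- exact: IdealD.
- exact: IdealMl.
- exact: IdealMr.
Qed.

(** From al + be = ga and al be = ga^2, the Hecke relation is ga^2 p_ga(s_1), a unit multiple of the
    projection. *)
Lemma hecke_ideal (k : fieldType) (j : k) (R : algType k) (s : nat -> R) (al be ga : k) (x : R) :
  1 + 1 = 0 :> k -> j * j = 1 + j -> all_roots j al be ga ->
  ideal_gen [set (s 1%N - al%:A) * (s 1%N - be%:A)] x <-> ideal_gen (eigen_ideal s ga) x.
Proof.
move=> char2 jj r.
have ga3 : ga * ga * ga = 1 := all_roots_cube char2 jj (all_rootsR (all_rootsR r)).
have e : (s 1%N - al%:A) * (s 1%N - be%:A) = (ga * ga) *: eigenproj ga%:A (s 1%N).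
  have oppR (y : R) : - y = y.
    by apply: (addrI y); rewrite subrr (addrr2 (R_char2 R char2)).
  have [s_ab ab] : al + be = ga /\ al * be = ga * ga.
    have kC (y : k) : j * y = y * j by exact: mulrC.
    by split; case: r {ga3}; f4_ring j (Nil k) (Nil (seq nat * seq nat)) char2 jj kC ltac:(idtac).
  rewrite !oppR eigenprojE !scalerDr !scalerA ga3 mulrDl !mulrDr mulrA ga3 mul1r.
  rewrite mulr_algl mulr_algr -addrA -scalerAl mul1r scalerA ab.
  rewrite scale1r addrC; congr (_ + _).
  by rewrite addrA -scalerDl (addrC be) s_ab addrC.
split; first exact: ideal_gen_scale e.
by apply: (@ideal_gen_scale _ _ ga); rewrite e scalerA mulrA ga3 scale1r.
Qed.

Lemma main_relE (k : comNzRingType) (n : nat) :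
  main_rel k n = quat_rel (galg_of k (sgen n 1)) (galg_of k (sgen n 2)).
Proof.
have inv i : ((sgen n i)^-1 = sgen n i * sgen n i)%g.
  by apply: (mulgI (sgen n i)); rewrite mulgV mulgA -(sgen_cube n i) !expgS expg0 mulg1 mulgA.
have e1 g h : galg_of k (g * (h * h))%g =
    galg_of k g * galg_of k h * galg_of k h :> group_algebra k (gamma n).
  by rewrite mulgA 2!galg_ofM.
have e2 g h : galg_of k (g * g * h)%g =
    galg_of k g * galg_of k g * galg_of k h :> group_algebra k (gamma n).
  by rewrite 2!galg_ofM.
by rewrite /main_rel !inv !e1 !e2.
Qed.

(** H is R modulo (X): p exists because Y lies in (X), e because (X) lies in the three ideals, and e
    is injective because (X) is their whole intersection. *)
Lemma quotient_embedding (k : fieldType) (R : algType k) (Y X Z0 Z1 Z2 : set R)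
    (d : nat) (f : R -> 'rV[k]_d) :
  linear f -> (forall u, exists x, f x = u) -> (0 < d)%N ->
  (forall x, f x = 0 <-> ideal_gen X x) ->
  (forall x, ideal_gen X x <->
     [/\ ideal_gen Z0 x, ideal_gen Z1 x & ideal_gen Z2 x]) ->
  (forall y, Y y -> ideal_gen X y) ->
  exists (H : falgType k) (p : {rmorphism quot_alg Y -> H})
      (e : {rmorphism H -> (quot_alg Z0 * quot_alg Z1 * quot_alg Z2)%type}),
    [/\ [/\ scalable p, (forall y, exists x, p x = y) & \dim {: H} = d],
        [/\ scalable e, injective e
          & forall x, e (p (quot_proj Y x)) =
              (quot_proj Z0 x, quot_proj Z1 x, quot_proj Z2 x)]
      & forall x, p (quot_proj Y x) = 0 <-> ideal_gen X x].
Proof.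
move=> f_lin f_surj d_gt0 f_ker XZ YX.
have [H [pi [lift [piZ liftE lift_inj pi_surj dimH]]]] :=
  fd_quot_exists f_lin f_surj f_ker d_gt0.
have pi0 x : pi x = 0 <-> ideal_gen X x.
  split=> [x0|Ix].
    by apply/quot_proj_eq0; rewrite -liftE x0 -(rmorph0 pi) liftE rmorph0.
  by apply: lift_inj; rewrite liftE -(rmorph0 pi) liftE rmorph0; apply/quot_proj_eq0.
pose F (x : R) : (quot_alg Z0 * quot_alg Z1 * quot_alg Z2)%type :=
  (quot_proj Z0 x, quot_proj Z1 x, quot_proj Z2 x).
have F0 x : F x = 0 <-> ideal_gen X x.
  split=> [[/quot_proj_eq0 I0 /quot_proj_eq0 I1 /quot_proj_eq0 I2]|]; first exact/XZ.
  by case/XZ=> /quot_proj_eq0 e0 /quot_proj_eq0 e1 /quot_proj_eq0 e2; rewrite /F e0 e1 e2.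
have FB : zmod_morphism F.
  by move=> x y; rewrite /F !rmorphB.
have FM : monoid_morphism F.
  by split=> [|x y]; rewrite /F ?rmorph1 ?rmorphM.
pose F' : {rmorphism R -> (quot_alg Z0 * quot_alg Z1 * quot_alg Z2)%type} :=
  HB.pack F (GRing.isZmodMorphism.Build _ _ F FB) (GRing.isMonoidMorphism.Build _ _ F FM).
pose proj : {rmorphism R -> quot_alg Y} := @quot_proj k R Y.
have proj_surj (y : quot_alg Y) : exists x, proj x = y := quot_proj_surj y.
have proj0 x : proj x = 0 -> pi x = 0.
  by move=> /quot_proj_eq0 Ix; apply/pi0; exact: ideal_gen_sub Ix.
have [p pE] := rmorph_factor proj_surj proj0.
have [|e eE] := @rmorph_factor _ _ _ pi F' pi_surj.
  by move=> x /pi0/F0.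
exists H, p, e; split; [split|split|] => //.
- move=> c y; have [x <-] := proj_surj y.
  rewrite -[_ *: _](quot_proj_scalable Y c x) -[quot_proj _ _]/(proj _) !pE.
  exact: piZ.
- by move=> y; have [x <-] := pi_surj y; exists (proj x).
- move=> c y; have [x <-] := pi_surj y.
  by rewrite -piZ !eE; congr (_, _, _); exact: quot_proj_scalable.
- move=> y z; have [x <-] := pi_surj y; have [x' <-] := pi_surj z => exx'.
  apply/eqP; rewrite -subr_eq0 -rmorphB; apply/eqP/pi0/F0.
  by rewrite -[F _]/(F' _) rmorphB -!eE exx' subrr.
- by move=> x; rewrite -[quot_proj _ x]/(proj x) pE eE.
- by move=> x; rewrite -[quot_proj _ x]/(proj x) pE; exact: pi0.
Qed.

Theorem mainTheorem2 (k : fieldType) (k_char2 : 2%N \in [pchar k])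
    (j : k) (j_F4 : j ^+ 2 + j + 1 = 0) (n : nat) (le3n : (3 <= n)%N) :
  exists (H : falgType k) (p : {rmorphism kK k le3n -> H})
      (e : {rmorphism H ->
        (hecke n 1 j * hecke n 1 (j ^+ 2) * hecke n j (j ^+ 2))%type}),
    [/\ [/\ scalable p, (forall y, exists x, p x = y)
          & \dim {: H} = (3 * (n`! - 1))%N],
        [/\ scalable e, injective e
          & forall x : group_algebra k (gamma n),
              e (p (quot_proj [set q_elt k le3n] x)) =
                (quot_proj [set hecke_rel n 1 j] x,
                 quot_proj [set hecke_rel n 1 (j ^+ 2)] x,
                 quot_proj [set hecke_rel n j (j ^+ 2)] x)]
      & forall x : group_algebra k (gamma n),
          p (quot_proj [set q_elt k le3n] x) = 0
            <-> ideal_gen [set main_rel k n] x].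
Proof.
have char2 : 1 + 1 = 0 :> k by have := pcharf0 k_char2.
have jj : j * j = 1 + j.
  transitivity (j ^+ 2 + j + 1 + (1 + j)); last by rewrite j_F4 add0r.
  by rewrite expr2 -!addrA (addrA 1 1) char2 add0r (addrr2 char2) addr0.
have n_gt2 : (2 < n)%N := le3n.
pose R : algType k := group_algebra k (gamma n).
pose S i : R := galg_of k (sgen n i).
have cub : cubic_algebra n S := gamma_cubic_algebra k n.
have [d [f [f_lin f_surj f_ker dE]]] := eigen_ideal_image char2 jj n_gt2 cub.
have XE : [set main_rel k n] = [set quat_rel (S 1%N) (S 2%N)] by rewrite main_relE.
have quatP x : ideal_gen [set main_rel k n] x <->
    [/\ ideal_gen (eigen_ideal S 1) x, ideal_gen (eigen_ideal S j) x
      & ideal_gen (eigen_ideal S (1 + j)) x].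
  by rewrite XE; exact: (quat_rel_idealP char2 jj n_gt2 cub).
have d_gt0 : (0 < d)%N.
  rewrite dE muln_gt0 /= subn_gt0; apply: leq_trans (fact_geq n); exact: ltnW.
rewrite -dE (_ : j ^+ 2 = 1 + j); last by rewrite expr2.
have hI al be ga x (r : all_roots j al be ga) := hecke_ideal S x char2 jj r.
have heckeP x : ideal_gen [set main_rel k n] x <->
    [/\ ideal_gen [set hecke_rel n 1 j] x, ideal_gen [set hecke_rel n 1 (1 + j)] x
      & ideal_gen [set hecke_rel n j (1 + j)] x].
  (* A Hecke algebra for two roots belongs to the ideal of the third one, so the order of the three
     ideals is reversed. *)
  split=> [/quatP[I0 I1 I2]|[I2 I1 I0]].
    split; [exact: (proj2 (hI _ _ _ x (AllRoots012 j)) I2)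
      | exact: (proj2 (hI _ _ _ x (AllRoots021 j)) I1)
      | exact: (proj2 (hI _ _ _ x (AllRoots120 j)) I0)].
  apply/quatP; split; [exact: (proj1 (hI _ _ _ x (AllRoots120 j)) I0)
      | exact: (proj1 (hI _ _ _ x (AllRoots021 j)) I1)
      | exact: (proj1 (hI _ _ _ x (AllRoots012 j)) I2)].
have f_ker' x : f x = 0 <-> ideal_gen [set main_rel k n] x.
  by split=> [/f_ker/quatP | /quatP/f_ker].
apply: (quotient_embedding f_lin f_surj d_gt0 f_ker' heckeP).
by move=> _ ->; rewrite XE; exact: q_elt_mem char2 jj.
Qed.
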